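(* Let $p>1$. Suppose the Drift Assumption, the Unbiased Noise Assumption, the $p$-th Moment Noise Assumption (with this $p$) and the Lipschitz Assumption (all described in the context) hold for the stochastic approximation iteration $x_{k+1}=x_k+\alpha_k\big(H(x_k)-x_k+w_k\big)$. Let $(\alpha_k)_{k\ge 0}$ be a non-increasing sequence of positive step sizes with $$\sum_{k=0}^\infty \alpha_k=\infty,\qquad \sum_{k=0}^\infty \alpha_k^{p}<\infty .$$ Then $x^\star$ is the unique solution of $H(x)=x$, and $x_k\to x^\star$ almost surely.
   Context: Let $\|\cdot\|$ denote the Euclidean norm on $\mathbb{R}^d$ and $\langle\cdot,\cdot\rangle$ the Euclidean inner product. Let $H:\mathbb{R}^d\to\mathbb{R}^d$ and consider the stochastic approximation iteration $x_{k+1}=x_k+\alpha_k\big(H(x_k)-x_k+w_k\big)$, $k\ge 0$, where $x_0$ is an initial point, $(\alpha_k)_{k\ge0}$ are positive step sizes and $(w_k)_{k\ge0}$ are random vectors in $\mathbb{R}^d$ defined on a common probability space. Let $\mathcal F_k=\sigma(x_0,x_1,\dots,x_k)$. Drift Assumption: there is $x^\star\in\mathbb{R}^d$ with $H(x^\star)=x^\star$, a differentiable function $\Phi:\mathbb{R}^d\to[0,\infty)$ and constants $\eta,c_1,c_2,L_2>0$ such that (i) $\langle\nabla\Phi(x-x^\star),H(x)-x\rangle\le-\eta\,\Phi(x-x^\star)$ for all $x\in\mathbb{R}^d$; (ii) $\Phi(y)\le\Phi(x)+\langle\nabla\Phi(x),y-x\rangle+\frac{L_2}{2}\|y-x\|^2$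 for all $x,y\in\mathbb{R}^d$; (iii) $c_1\|x-x^\star\|^2\le\Phi(x-x^\star)\le c_2\|x-x^\star\|^2$ for all $x\in\mathbb{R}^d$. Unbiased Noise Assumption: each $w_k$ is integrable and $\mathbb{E}[w_k\mid\mathcal F_k]=0$ almost surely for all $k\ge0$. $p$-th Moment Noise Assumption (for a given $p>1$): there are constants $A_p>0$, $B_p\ge0$ such that $\mathbb{E}[\|w_k\|^p\mid\mathcal F_k]\le A_p+B_p\|x_k-x^\star\|^p$ almost surely for all $k\ge 0$. Lipschitz Assumption: there is $C>0$ with $\|H(x)-H(y)\|\le C\|x-y\|$ for all $x,y\in\mathbb{R}^d$. *)

(* Defs.v *)
From HB Require Import structures.
From mathcomp Require Import all_boot all_order all_algebra.
From mathcomp Require Import all_classical all_reals all_analysis.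
Set Implicit Arguments. Unset Strict Implicit. Unset Printing Implicit Defensive.
Import Order.TTheory GRing.Theory Num.Theory.
Import numFieldNormedType.Exports.
Local Open Scope classical_set_scope.
Local Open Scope ring_scope.

Section Defs.
Variables (R : realType) (d : nat).

Definition inner (u v : 'rV[R]_d) : R := \sum_(i < d) u 0 i * v 0 i.
Definition enorm (u : 'rV[R]_d) : R := Num.sqrt (inner u u).

Definition grad (Phi : 'rV[R]_d -> R) (x : 'rV[R]_d) : 'rV[R]_d :=
  \row_(i < d) ('d Phi x (delta_mx 0 i : 'rV[R]_d)).

Fixpoint sa_iter (T : Type) (H : 'rV[R]_d -> 'rV[R]_d) (alpha : nat -> R)
    (w : nat -> T -> 'rV[R]_d) (x0 : 'rV[R]_d) (k : nat) (om : T) : 'rV[R]_d :=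
  match k with
  | 0%N => x0
  | k'.+1 => let xk := sa_iter H alpha w x0 k' om in
             xk + alpha k' *: (H xk - xk + w k' om)
  end.

Definition filtr (d0 : measure_display) (T : measurableType d0)
    (x : nat -> T -> 'rV[R]_d) (k : nat) : set (set T) :=
  smallest (sigma_algebra setT)
    [set A | exists j : nat, exists i : 'I_d, exists B : set R,
       [/\ (j <= k)%N, measurable B & A = (fun om => x j om 0 i) @^-1` B]].

End Defs.

(* Main.v *)
Require Import Defs.
From HB Require Import structures.
From mathcomp Require Import all_boot all_order all_algebra.
From mathcomp Require Import all_classical all_reals all_analysis.
From mathcomp Require Import measurable_realfun ring lra.
Set Implicit Arguments. Unset Strict Implicit. Unset Printing Implicit Defensive.
Import Order.TTheory GRing.Theory Num.Theory.
Import numFieldNormedType.Exports.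
Local Open Scope classical_set_scope.
Local Open Scope ring_scope.

(** Truncate the noise at the event [E k] that [alpha k * |w k| <= r k], where
   [r k = 1 + |x k - xstar|]; the moment assumption gives
   [P (~ E k) <= (Ap + Bp) * alpha k ^ p], so by Borel-Cantelli almost surely
   [E k] fails only finitely often. On the truncated dynamics all moments are
   finite, and one may use the Lyapunov function [V ^ m], [V = Phi (x k - xstar)],
   with an integer [m >= p] even though the noise only has [p] moments: a Taylor
   bound for [(a + b) ^ m] and [u ^ 2 <= alpha ^ 2 + (alpha ^ 2 + alpha ^ p) y ^ p],
   [u ^ (2 m) <= alpha ^ p y ^ p] (for [u = alpha y <= 1], [y = |w k| / r k]) give
   a conditional drift [E V' ^ m <= (1 - c alpha) V ^ m + K alpha ^ p]. The terms
   of order [alpha ^ 2 * V ^ (m - 1)], whose coefficients need not be summable when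
   [p > 2], are absorbed as
   [eps * alpha * V ^ m + eps^-(m - 1) * alpha ^ (m + 1)]. As [alpha ^ p] is
   summable and [alpha] is not, the expectation of [V ^ m] has inferior limit [0],
   and Ville's maximal inequality then yields almost sure convergence. *)

(** * Integrals against weights measurable for a sub-sigma-algebra *)

Section WeightedIntegral.
Context (d0 : measure_display) (T : measurableType d0) (R : realType).
Variables (P : {measure set T -> \bar R}) (G : set (set T)).
Hypothesis GT : G `<=` measurable.
Local Notation TG := (g_sigma_algebraType G).
Import HBNNSimple.

Lemma measurable_g_sigma (A : set T) : <<s G >> A -> measurable A.
Proof. by apply: smallest_sub GT A; exact: sigma_algebra_measurable. Qed.

Lemma measurable_fun_g_sigma (g : T -> R) :
  measurable_fun [set: TG] (g : TG -> R) -> measurable_fun [set: T] g.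
Proof.
move=> mg _ B mB; apply: measurable_g_sigma; exact: (mg measurableT B mB).
Qed.

Lemma integral_nnsfunM (h : {nnsfun TG >-> R}) (f : T -> R) :
  (forall x, 0 <= f x) -> measurable_fun [set: T] f ->
  (\int[P]_x (h x * f x)%:E = \sum_(y \in range h)
     y%:E * \int[P]_(x in h @^-1` [set y]) (f x)%:E)%E.
Proof.
move=> f0 mf.
have mh y : measurable ((h : T -> R) @^-1` [set y]).
  apply: measurable_g_sigma.
  by have := measurable_funP h measurableT _ (measurable_set1 y); rewrite setTI.
transitivity (\int[P]_x \sum_(y \in range h)
    (y * \1_(h @^-1` [set y]) x * f x)%:E)%E.
  apply: eq_integral => x _; rewrite fsumEFin; last exact: fimfunP.
  by rewrite [in LHS]fimfunE mulr_fsuml.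
have yh0 y x : 0 <= y * \1_(h @^-1` [set y]) x.
  by rewrite -lee_fin EFinM; exact: nnfun_muleindic_ge0.
rewrite ge0_integral_fsum//.
- apply: eq_fsbigr => y /set_mem[x _ hxy].
  have y0 : 0 <= y by rewrite -hxy.
  under eq_integral do rewrite -mulrA EFinM.
  rewrite ge0_integralZl ?lee_fin//.
  + rewrite [in RHS]integral_mkcond; congr (_ * _)%E.
    apply: eq_integral => z _; rewrite /patch indicE.
    by case: ifPn => _ /=; rewrite ?mul1r ?mul0r.
  + exact/measurable_EFinP/measurable_funM.
  + by move=> z _; rewrite lee_fin mulr_ge0.
- move=> y; apply/measurable_EFinP/measurable_funM => //.
  exact: measurable_funM.
- by move=> y x _; rewrite lee_fin mulr_ge0.
Qed.

Lemma cvg_integral_nnsfun_approxM (g f : T -> R)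
    (mg : measurable_fun [set: TG] (EFin \o g)) :
  (forall x, 0 <= g x) -> (forall x, 0 <= f x) -> measurable_fun [set: T] f ->
  (\int[P]_x (nnsfun_approx measurableT mg n x * f x)%:E @[n --> \oo] -->
   \int[P]_x (g x * f x)%:E)%E.
Proof.
move=> g0 f0 mf; set h := nnsfun_approx _ _.
have -> : (\int[P]_x (g x * f x)%:E =
    \int[P]_x limn (fun n => (h n x * f x)%:E))%E.
  apply: eq_integral => x _; apply/esym/cvg_lim => //.
  under eq_fun do rewrite EFinM.
  rewrite EFinM; apply: cvgeZr => //.
  by apply: cvg_nnsfun_approx => // y _; rewrite lee_fin.
apply: cvg_monotone_convergence => //.
- move=> n; apply/measurable_EFinP/measurable_funM => //.
  by apply: measurable_fun_g_sigma; exact: measurable_funP.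
- by move=> n x _; rewrite lee_fin mulr_ge0.
- move=> x _ m n mn; rewrite lee_fin ler_wpM2r//.
  exact: (lefP _ _ (nd_nnsfun_approx measurableT mg mn) x).
Qed.

(** Linearity gives the comparison for simple weights, whose level sets lie in [<<s G >>], and
    monotone convergence passes to [g]. This plays the part of taking a known factor out of a
    conditional expectation, the moment assumption being given in integrated form. *)
Lemma le_weighted_integral (g f h : T -> R) :
  (forall x, 0 <= g x) -> measurable_fun [set: TG] (g : TG -> R) ->
  (forall x, 0 <= f x) -> measurable_fun [set: T] f ->
  (forall x, 0 <= h x) -> measurable_fun [set: T] h ->
  (forall A, <<s G >> A ->
     (\int[P]_(x in A) (f x)%:E <= \int[P]_(x in A) (h x)%:E)%E) ->
  (\int[P]_x (g x * f x)%:E <= \int[P]_x (g x * h x)%:E)%E.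
Proof.
move=> g0 mg f0 mf h0 mh fh.
have mg' : measurable_fun [set: TG] (EFin \o (g : TG -> R)).
  exact/measurable_EFinP.
have cf := cvg_integral_nnsfun_approxM mg' g0 f0 mf.
have ch := cvg_integral_nnsfun_approxM mg' g0 h0 mh.
rewrite -(cvg_lim _ cf)// -(cvg_lim _ ch)//.
apply: lee_lim; [by apply/cvg_ex; eexists; exact: cf|
  by apply/cvg_ex; eexists; exact: ch|].
apply: nearW => n; rewrite !integral_nnsfunM//.
apply: lee_fsum; first exact: fimfunP.
move=> y [x _ <-]; apply: lee_wpmul2l; first by rewrite lee_fin.
apply: fh.
by have := measurable_funP (nnsfun_approx measurableT mg' n) measurableT
  _ (measurable_set1 (nnsfun_approx measurableT mg' n x)); rewrite setTI.
Qed.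

(* Adding the bound [M] to [g] makes it a nonnegative weight, so that the
   previous lemma applies to the positive and negative parts of [f]. *)
Lemma weighted_integral0 (g f : T -> R) (M : R) :
  (forall x, `|g x| <= M) -> measurable_fun [set: TG] (g : TG -> R) ->
  P.-integrable [set: T] (EFin \o f) ->
  (forall A, <<s G >> A -> (\int[P]_(x in A) (f x)%:E = 0)%E) ->
  (\int[P]_x (g x * f x)%:E = 0)%E.
Proof.
move=> gM mg fi f0.
have mf : measurable_fun [set: T] f by apply/measurable_EFinP/(measurable_int P).
have mgT := measurable_fun_g_sigma mg.
pose g' x := g x + M; pose fp x := Num.max (f x) 0; pose fn x := Num.max (- f x) 0.
have fE x : f x = fp x - fn x by rewrite /fp /fn; case: (leP (f x) 0) => ?; case: (leP (- f x) 0) => ?; lra.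
have g'0 x : 0 <= g' x.
  by rewrite /g' -lerBlDr sub0r lerNl; apply: le_trans (gM x); rewrite -normrN ler_norm.
have mg' : measurable_fun [set: TG] (g' : TG -> R) by apply: measurable_funD.
have bg' : [bounded g' x | x in [set: T]].
  exists (M + `|M|); split; first exact: num_real.
  move=> z hz x _; apply: (le_trans (ler_normD _ _)); apply: le_trans (ltW hz).
  by rewrite lerD2r.
have bg : [bounded g x | x in [set: T]].
  exists M; split; first exact: num_real.
  by move=> z hz x _; apply: le_trans (ltW hz).
have fp0 x : 0 <= fp x by rewrite le_max lexx orbT.
have fn0 x : 0 <= fn x by rewrite le_max lexx orbT.
have mfp : measurable_fun [set: T] fp by apply: measurable_maxr.
have mfn : measurable_fun [set: T] fn.
  by apply: measurable_maxr => //; exact: measurable_funN.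
have lef h : (forall x, 0 <= h x) -> (forall x, h x <= `|f x|) ->
    measurable_fun [set: T] h -> P.-integrable [set: T] (EFin \o h).
  move=> h0 hf mh; apply: le_integrable fi => //; first exact/measurable_EFinP.
  by move=> x _ /=; rewrite lee_fin ger0_norm.
have fpi : P.-integrable [set: T] (EFin \o fp).
  by apply: lef => // x; rewrite ge_max ler_norm normr_ge0.
have fni : P.-integrable [set: T] (EFin \o fn).
  by apply: lef => // x; rewrite ge_max -normrN ler_norm normr_ge0.
have eqA A : <<s G >> A ->
    (\int[P]_(x in A) (fp x)%:E = \int[P]_(x in A) (fn x)%:E)%E.
  move=> GA; have mA := measurable_g_sigma GA.
  have fpA := integrableS measurableT mA (@subsetT _ _) fpi.
  have fnA := integrableS measurableT mA (@subsetT _ _) fni.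
  have := f0 A GA; under eq_integral do rewrite fE EFinB.
  rewrite integralB// => /eqP; rewrite sube_eq ?add0e; first by move/eqP.
    exact: integrable_fin_num.
  by rewrite fin_num_adde_defr//; exact: integrable_fin_num.
have gp := integrableMr measurableT (measurable_fun_g_sigma mg') bg' fpi.
have gn := integrableMr measurableT (measurable_fun_g_sigma mg') bg' fni.
have mf' := integrableZl measurableT M fi.
have eqg : (\int[P]_x (g' x * fp x)%:E = \int[P]_x (g' x * fn x)%:E)%E.
  by apply/le_anti/andP; split; apply: le_weighted_integral => // A GA; rewrite eqA.
transitivity (\int[P]_x ((g' x * fp x)%:E - (g' x * fn x)%:E - M%:E * (f x)%:E))%E.
  apply: eq_integral => x _; rewrite -EFinM -!EFinB; congr EFin.
  by rewrite /g' (fE x); ring.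
rewrite integralB//; last exact: integrableB.
rewrite integralB// eqg integralZl// f0 ?mule0 ?sube0; last first.
  exact: (@measurableT _ TG).
apply/eqP; rewrite sube_eq ?add0e//; exact: integrable_fin_num gn.
Qed.

End WeightedIntegral.

(** * Almost supermartingales on decreasing events and their convergence to zero *)

Section Supermartingale.
Context (d0 : measure_display) (T : measurableType d0) (R : realType).
Variables (P : {measure set T -> \bar R}) (G : nat -> set (set T)).
Hypothesis GT : forall k, G k `<=` measurable.
Hypothesis Gmono : forall k, G k `<=` G k.+1.
Variables (W : nat -> T -> R) (D : nat -> set T) (a b : nat -> R).
Hypothesis W0 : forall k x, 0 <= W k x.
Hypothesis mW : forall k,
  measurable_fun [set: g_sigma_algebraType (G k)] (W k).
Hypothesis GD : forall k, <<s G k >> (D k).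
Hypothesis decD : forall k, D k.+1 `<=` D k.
Hypothesis D0fin : (\int[P]_(x in D 0%N) (W 0%N x)%:E < +oo)%E.
Hypothesis a0 : forall k, 0 <= a k.
Hypothesis b0 : forall k, 0 <= b k.
(** Integrated counterpart of [E[W (k+1); D (k+1) | G k] <= (1 - a k) * W k + b k] on [D k]. The
    decrease stands on the left to avoid subtracting extended reals, and [b k] is a total cost, the
    same for every [A]. *)
Hypothesis drift : forall k A, <<s G k >> A -> A `<=` D k ->
  (\int[P]_(x in A `&` D k.+1) (W k.+1 x)%:E +
     (a k)%:E * \int[P]_(x in A) (W k x)%:E <=
   \int[P]_(x in A) (W k x)%:E + (b k)%:E)%E.

Let mWT k : measurable_fun [set: T] (W k).
Proof. exact: (measurable_fun_g_sigma (@GT k) (@mW k)). Qed.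

Let mGT k A : <<s G k >> A -> measurable A.
Proof. exact: (measurable_g_sigma (@GT k)). Qed.

Let mWe k A : measurable_fun A (fun x => (W k x)%:E).
Proof. exact/measurable_EFinP/measurable_funTS. Qed.

Let W0e k (A : set T) x : A x -> (0 <= (W k x)%:E)%E.
Proof. by rewrite lee_fin. Qed.

Let intW0 k A : (0 <= \int[P]_(x in A) (W k x)%:E)%E.
Proof. by apply: integral_ge0 => x /W0e. Qed.

Let GS k A : <<s G k >> A -> <<s G k.+1 >> A.
Proof. by apply: sub_smallest2r; [exact: smallest_sigma_algebra|exact: Gmono]. Qed.

Let i k : R := fine (\int[P]_(x in D k) (W k x)%:E).

Let drift0 k A : <<s G k >> A -> A `<=` D k ->
  (\int[P]_(x in A `&` D k.+1) (W k.+1 x)%:E <=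
   \int[P]_(x in A) (W k x)%:E + (b k)%:E)%E.
Proof.
move=> GA AD; apply: le_trans (drift GA AD); rewrite leeDl//.
by apply: mule_ge0; [rewrite lee_fin|exact: intW0].
Qed.

Let iE k : (\int[P]_(x in D k) (W k x)%:E = (i k)%:E)%E.
Proof.
rewrite fineK// ge0_fin_numE; last exact: intW0.
elim: k => // k ih; have := drift0 (@GD k) (@subset_refl _ _).
rewrite setIidr// => /le_lt_trans; apply.
by rewrite lte_add_pinfty// ltry.
Qed.

Let i0 k : 0 <= i k.
Proof. by rewrite -lee_fin -iE intW0. Qed.

Let i_drift k : i k.+1 + a k * i k <= i k + b k.
Proof.
have := drift (@GD k) (@subset_refl _ _); rewrite setIidr//.
by rewrite !iE -EFinM -!EFinD lee_fin.
Qed.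

Let i_sum n j :
  i (n + j) + \sum_(n <= k < n + j) a k * i k <= i n + \sum_(n <= k < n + j) b k.
Proof.
elim: j => [|j ih]; first by rewrite addn0 !big_geq.
rewrite addnS !big_nat_recr ?leq_addr//=; have := i_drift (n + j); lra.
Qed.

Hypothesis suma : forall M n, exists K, M <= \sum_(n <= k < K) a k.
Hypothesis sumb : forall e, 0 < e -> exists n, forall K, \sum_(n <= k < K) b k < e.

(** If [i] stayed at or above [e] from some time on, [i_sum] would bound [e] times the divergent sum
    of the [a k]. *)
Let i_small e n : 0 < e -> exists2 k, (n <= k)%N & i k < e.
Proof.
move=> e0; have [N bN] := sumb ltr01.
pose m := maxn n N; apply: contrapT => noi.
have ige k : (m <= k)%N -> e <= i k.
  move=> mk; rewrite leNgt; apply/negP => ik; apply: noi; exists k => //.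
  by apply: leq_trans mk; rewrite leq_maxl.
(* By the choice of [m] less than [i m + 1] is available, while this [K] would make [e] times the
   sum of the [a k] at least [i m + 2]. *)
have [K hK] := suma ((i m + 2) / e) m.
have [Km|mK] := leqP K m.
  move: hK; rewrite big_geq// leNgt divr_gt0//; have := i0 m; lra.
have := i_sum m (K - m); rewrite subnKC ?(ltnW mK)//.
have : \sum_(m <= k < K) b k < 1.
  apply: le_lt_trans (bN K); rewrite [leRHS](@big_cat_nat _ _ _ m)/= ?(ltnW mK) ?leq_maxr//.
  by rewrite lerDr sumr_ge0.
have : e * \sum_(m <= k < K) a k <= \sum_(m <= k < K) a k * i k.
  rewrite mulr_sumr; rewrite !big_nat; apply: ler_sum => k /andP[mk _].
  by rewrite mulrC ler_wpM2l// ige.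
move: hK; rewrite ler_pdivrMr// => hK.
have := i0 K; rewrite mulrC in hK; lra.
Qed.

(** First-passage decomposition: [B e n j] says that [n + j] is the first time from [n] on at which
    [W] reaches [e], and [Q e n j] that no such time has come before [n + j], all while the path
    stays in [D]. *)
Let Q (e : R) (n : nat) := fix Q (j : nat) : set T :=
  match j with
  | 0%N => D n
  | j'.+1 => Q j' `&` [set x | W (n + j')%N x < e] `&` D (n + j').+1
  end.
Let B e n j := Q e n j `&` [set x | e <= W (n + j)%N x].

Let GWlt k e : <<s G k >> [set x | W k x < e].
Proof.
have := @mW k measurableT _ (measurable_itv `]-oo, e[).
by rewrite setTI; congr (<<s G k >> _).
Qed.

Let GWge k e : <<s G k >> [set x | e <= W k x].
Proof.
have := @mW k measurableT _ (measurable_itv `[e, +oo[).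
rewrite setTI; congr (<<s G k >> _).
by apply/seteqP; split => x /=; rewrite in_itv/= andbT.
Qed.

Let GI k X Y : <<s G k >> X -> <<s G k >> Y -> <<s G k >> (X `&` Y).
Proof. exact: (@measurableI _ (g_sigma_algebraType (G k))). Qed.

Let GQ e n j : <<s G (n + j) >> (Q e n j).
Proof.
elim: j => [|j ih]; first (rewrite addn0; exact: (@GD n)).
rewrite addnS; exact: (GI (GS (GI ih (@GWlt _ _))) (@GD _)).
Qed.

Let QD e n j : Q e n j `<=` D (n + j).
Proof. by case: j => [|j] /=; rewrite ?addn0// addnS => x []. Qed.

Let GB e n j : <<s G (n + j) >> (B e n j).
Proof. exact: (GI (@GQ _ _ _) (@GWge _ _)). Qed.

(** Ville's inequality up to a finite horizon. At each step [Q] splits into [B], where [W] is at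
    least [e] and the integral pays for [e * P B], and the rest [A], whose integral [drift0] carries
    to the next time at the cost of one [b]. *)
Let maximal e n j : 0 < e ->
  (e%:E * \sum_(0 <= l < j) P (B e n l) + \int[P]_(x in Q e n j) (W (n + j) x)%:E
   <= (i n + \sum_(n <= k < n + j) b k)%:E)%E.
Proof.
move=> e0; elim: j => [|j ih].
  by rewrite addn0 !big_geq//= mule0 add0e addr0 iE.
pose A := Q e n j `&` [set x | W (n + j)%N x < e].
have GA : <<s G (n + j) >> A by exact: (GI (@GQ _ _ _) (@GWlt _ _)).
have AD : A `<=` D (n + j) by apply: subIset; left; exact: QD.
have QE : Q e n j = B e n j `|` A.
  rewrite /B /A -setIUr; apply/esym/setIidl => x _ /=.
  by case: (leP e (W (n + j) x)); [left|right].
rewrite big_nat_recr// addnS [X in (_ <= (_ + X)%:E)%E]big_nat_recr ?leq_addr// [X in (_ <= X%:E)%E]addrA EFinD.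
rewrite ge0_muleDr//; last by apply: sume_ge0.
apply: (@le_trans _ _ (e%:E * \sum_(0 <= l < j) P (B e n l) + e%:E * P (B e n j)
   + (\int[P]_(x in A) (W (n + j) x)%:E + (b (n + j))%:E)))%E.
  by rewrite leeD2l//; exact: drift0.
rewrite addeA leeD2r//; apply: le_trans ih; rewrite -addeA leeD2l//.
have mB : measurable (B e n j) by exact: (mGT (@GB _ _ _)).
have mA : measurable A by exact: (mGT GA).
have BA : [disjoint B e n j & A].
  by apply/disj_setPS => x [[_ /= h1] [_ /= h2]]; move: h2; rewrite ltNge h1.
rewrite [in leRHS]QE ge0_integral_setU//; last by move=> x /W0e.
rewrite leeD2r// -integral_cst//; apply: ge0_le_integral => //.
- by move=> x _; rewrite lee_fin ltW.
- by move=> x [_ /=]; rewrite lee_fin.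
Qed.

Let P_hit e n r : 0 < e -> (forall K, i n + \sum_(n <= k < K) b k <= r) ->
  (P (\bigcup_j B e n j) <= (r / e)%:E)%E.
Proof.
move=> e0 br.
have mB j : measurable (B e n j) by exact: (mGT (@GB _ _ _)).
apply: (@le_trans _ _ (\sum_(0 <= j <oo) P (B e n j))%E).
  by apply: measure_sigma_subadditive => //; exact: bigcup_measurable.
apply: lime_le; first by apply: is_cvg_nneseries.
apply: nearW => j.
rewrite -(@lee_pmul2l _ e%:E)//.
have -> : (e%:E * (r / e)%:E = r%:E)%E.
  by rewrite -EFinM mulrCA divff ?mulr1// gt_eqF.
apply: le_trans (le_trans _ (@maximal e n j e0)) _.
  by rewrite leeDl// intW0.
by rewrite lee_fin.
Qed.

Let in_hit e n x : (forall k, D k x) -> (exists2 k, (n <= k)%N & e <= W k x) ->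
  (\bigcup_j B e n j) x.
Proof.
move=> Dx [k nk ek].
have : exists j, e <= W (n + j) x by exists (k - n)%N; rewrite subnKC.
move=> /ex_minnP[j ej jmin]; exists j => //; split => //.
have {jmin} : forall l, (l < j)%N -> W (n + l) x < e.
  by move=> l lj; rewrite ltNge; apply/negP => /jmin; rewrite leqNgt lj.
elim: j {ej} => [_|j ih hj]; first exact: Dx.
have Qx : Q e n j x by apply: ih => l lj; apply: hj; rewrite ltnS ltnW.
exact: (conj (conj Qx (hj j (ltnSn j))) (Dx _)).
Qed.

Let negligible_hit e : 0 < e ->
  P.-negligible [set x | (forall k, D k x) /\
                         forall n, exists2 k, (n <= k)%N & e <= W k x].
Proof.
move=> e0; pose N := \bigcap_n \bigcup_j B e n j.
have mU n : measurable (\bigcup_j B e n j).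
  by apply: bigcup_measurable => j _; exact: (mGT (@GB _ _ _)).
have mN : measurable N by exact: bigcap_measurable.
exists N; split => //; last first.
  by move=> x [Dx hx] n _; apply: in_hit.
apply/le_anti/andP; split => //.
apply/lee_addgt0Pr => r r0; rewrite add0e.
(* One half of the budget [r * e] goes to the tail of the [b k], the other to [i n], which [i_small]
   makes small at some late time [n]; dividing by the level [e] leaves [r]. *)
have re2 : 0 < r * e / 2 by rewrite divr_gt0// mulr_gt0.
have [m bm] := sumb re2.
have [n mn iN] := i_small m re2.
apply: (@le_trans _ _ (P (\bigcup_j B e n j))).
  by apply: le_measure; rewrite ?inE//; exact: bigcap_inf.
have -> : r = r * e / e by rewrite mulfK// gt_eqF.
apply: P_hit => // K.
suff : \sum_(n <= k < K) b k <= r * e / 2 by lra.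
apply: (le_trans _ (ltW (bm K))).
have [Kn|nK] := leqP K n; first by rewrite big_geq// sumr_ge0.
by rewrite [leRHS](@big_cat_nat _ _ _ n)/= ?(ltnW nK)// lerDr sumr_ge0.
Qed.

(** The levels [1 / (m + 1)] suffice, so only countably many null sets are discarded. *)
Lemma supermartingale_cvg0 :
  {ae P, forall x, (forall k, D k x) -> W k x @[k --> \oo] --> 0}.
Proof.
have : {ae P, forall x, forall m, ~ ((forall k, D k x) /\
    forall n, exists2 k, (n <= k)%N & m.+1%:R^-1 <= W k x)}.
  apply: ae_foralln => m; have := @negligible_hit m.+1%:R^-1.
  rewrite invr_gt0 ltr0n => /(_ isT); apply: negligibleS => x /=.
  exact: contrapT.
apply: filterS => x hx Dx; apply/cvgrPdist_lt => e e0.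
have [m me] : exists m : nat, m.+1%:R^-1 < e.
  have [m _ /(_ m (leqnn _)) hm] := near_infty_natSinv_lt (PosNum e0).
  by exists m.
have [n hn] : exists n, forall k, (n <= k)%N -> W k x < m.+1%:R^-1.
  apply: contrapT => hn; apply: (hx m); split => // n.
  apply: contrapT => hk; apply: hn; exists n => k nk.
  by rewrite ltNge; apply/negP => ek; apply: hk; exists k.
exists n => // k nk /=; rewrite sub0r normrN ger0_norm//.
exact: lt_trans (hn _ nk) me.
Qed.

End Supermartingale.

(** * Euclidean inner product and norm *)

Section Euclid.
Context (R : realType) (d : nat).
Implicit Types u v : 'rV[R]_d.

Lemma innerDl u v z : inner (u + v) z = inner u z + inner v z.
Proof. by rewrite -big_split; apply: eq_bigr => i _; rewrite mxE mulrDl. Qed.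

Lemma innerC u v : inner u v = inner v u.
Proof. by apply: eq_bigr => i _; rewrite mulrC. Qed.

Lemma innerZl (k : R) u v : inner (k *: u) v = k * inner u v.
Proof. by rewrite mulr_sumr; apply: eq_bigr => i _; rewrite mxE mulrA. Qed.

Lemma innerDr u v z : inner u (v + z) = inner u v + inner u z.
Proof. by rewrite innerC innerDl !(innerC u). Qed.

Lemma innerZr (k : R) u v : inner u (k *: v) = k * inner u v.
Proof. by rewrite innerC innerZl innerC. Qed.

Lemma inner_ge0 u : 0 <= inner u u.
Proof. by apply: sumr_ge0 => i _; rewrite -expr2 sqr_ge0. Qed.

Lemma enorm_ge0 u : 0 <= enorm u.
Proof. exact: sqrtr_ge0. Qed.

Lemma enorm_sqr u : enorm u ^+ 2 = inner u u.
Proof. by rewrite sqr_sqrtr// inner_ge0. Qed.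

Lemma coord_le_enorm u i : `|u 0 i| <= enorm u.
Proof.
rewrite -(@ler_pXn2r _ 2)// ?nnegrE ?enorm_ge0// enorm_sqr real_normK ?num_real//.
rewrite /inner (bigD1 i)//= -expr2 lerDl.
by apply: sumr_ge0 => j _; rewrite -expr2 sqr_ge0.
Qed.

Lemma enorm_eq0 u : enorm u = 0 -> u = 0.
Proof.
move=> u0; apply/rowP => i; rewrite mxE.
by apply/eqP; rewrite -normr_le0 -u0 coord_le_enorm.
Qed.

Lemma enormZ (k : R) u : enorm (k *: u) = `|k| * enorm u.
Proof.
rewrite /enorm innerZl innerZr mulrA -expr2 sqrtrM ?sqr_ge0//.
by rewrite sqrtr_sqr.
Qed.

Lemma cauchy_schwarz u v : `|inner u v| <= enorm u * enorm v.
Proof.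
wlog uv : u / 0 <= inner u v.
  move=> H; have [/H//|/ltW uv] := leP 0 (inner u v).
  have -> : inner u v = - inner (-1 *: u) v by rewrite innerZl; ring.
  have -> : enorm u = enorm (-1 *: u) by rewrite enormZ normrN1 mul1r.
  by rewrite normrN; apply: H; rewrite innerZl; lra.
rewrite ger0_norm//.
have [u0|u0] := eqVneq (enorm u) 0.
  by rewrite (enorm_eq0 u0) -(scale0r 0) innerZl enormZ normr0 !mul0r.
have [v0|v0] := eqVneq (enorm v) 0.
  by rewrite (enorm_eq0 v0) -(scale0r 0) innerZr enormZ normr0 !mul0r mulr0.
have ugt : 0 < enorm u by rewrite lt_def u0 enorm_ge0.
have vgt : 0 < enorm v by rewrite lt_def v0 enorm_ge0.
(* The square of [|v| u - |u| v] expands to [2 |u| |v| (|u| |v| - <u, v>)], and the positive factor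
   cancels. *)
have := inner_ge0 (enorm v *: u + (- enorm u) *: v).
rewrite !(innerDl, innerDr, innerZl, innerZr) -!enorm_sqr (innerC v u).
rewrite -subr_ge0 => h.
have : 0 <= (enorm u * enorm v) * (enorm u * enorm v - inner u v) by nra.
by rewrite pmulr_rge0 ?mulr_gt0// subr_ge0.
Qed.

Lemma ler_enormD u v : enorm (u + v) <= enorm u + enorm v.
Proof.
rewrite -(@ler_pXn2r _ 2)// ?nnegrE ?addr_ge0 ?enorm_ge0//.
rewrite enorm_sqr !(innerDl, innerDr) (innerC v u) sqrrD !enorm_sqr.
have := le_trans (ler_norm _) (cauchy_schwarz u v); lra.
Qed.

Lemma enorm_le_sum u : enorm u <= \sum_(i < d) `|u 0 i|.
Proof.
have s0 : 0 <= \sum_(i < d) `|u 0 i| by exact: sumr_ge0.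
rewrite -(@ler_pXn2r _ 2)// ?nnegrE ?enorm_ge0// enorm_sqr expr2 mulr_suml.
apply: ler_sum => i _; apply: le_trans (ler_norm _) _; rewrite normrM.
by rewrite ler_wpM2l// (bigD1 i)//= lerDl sumr_ge0.
Qed.

End Euclid.

(** * Power inequalities for a perturbed number *)

Section ScalarEstimates.
Context (R : realType).
Implicit Types a b l s t r v q eps : R.

(** Induction by multiplying with [a + b]: the cross term [n.+2 * a ^ (n + 1) * b ^ 2] joins the
    quadratic remainder, so [K] grows by [n.+2]. The term linear in [b] is kept exactly, since the
    noise in it will average out. *)
Lemma ler_exprD_taylor n : exists2 K : R, 0 <= K & forall a b, 0 <= a -> 0 <= a + b ->
  (a + b) ^+ n.+2 <= a ^+ n.+2 + n.+2%:R * a ^+ n.+1 * b + K * b ^+ 2 * (a + `|b|) ^+ n.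
Proof.
elim: n => [|n [K K0 ih]].
  by exists 1 => // a b _ _; rewrite expr0; lra.
exists (K + n.+2%:R) => [|a b a0 ab0]; first by rewrite addr_ge0.
have h1 : (a + b) ^+ n.+3 <= (a ^+ n.+2 + n.+2%:R * a ^+ n.+1 * b +
    K * b ^+ 2 * (a + `|b|) ^+ n) * (a + b).
  by rewrite (exprSr (a + b)) ler_wpM2r// ih.
apply: (le_trans h1).
have h2 : K * b ^+ 2 * (a + `|b|) ^+ n * (a + b) <= K * b ^+ 2 * (a + `|b|) ^+ n.+1.
  have X0 : 0 <= (a + `|b|) ^+ n by rewrite exprn_ge0 ?addr_ge0.
  rewrite (exprSr (a + `|b|)) -[leLHS]mulrA.
  rewrite ler_wpM2l ?(mulr_ge0 K0 (sqr_ge0 b))//.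
  by rewrite ler_wpM2l// lerD2l ler_norm.
have h3 : n.+2%:R * b ^+ 2 * a ^+ n.+1 <= n.+2%:R * b ^+ 2 * (a + `|b|) ^+ n.+1.
  rewrite ler_wpM2l ?(mulr_ge0 (ler0n _ _) (sqr_ge0 b))//.
  by rewrite lerXn2r ?nnegrE ?addr_ge0// lerDl.
have -> : (a ^+ n.+2 + n.+2%:R * a ^+ n.+1 * b + K * b ^+ 2 * (a + `|b|) ^+ n) * (a + b)
  = a ^+ n.+3 + n.+3%:R * a ^+ n.+2 * b + n.+2%:R * b ^+ 2 * a ^+ n.+1
    + K * b ^+ 2 * (a + `|b|) ^+ n * (a + b).
  have -> : n.+3%:R = n.+2%:R + 1 :> R by rewrite -natr1.
  by rewrite !exprS; ring.
lra.
Qed.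

Lemma exprD_le_sum n s t : 0 <= s -> 0 <= t ->
  (t + s) ^+ n <= 2 ^+ n * (t ^+ n + s ^+ n).
Proof.
wlog st : s t / s <= t.
  move=> H s0 t0; have [/H|/ltW/H] := leP s t; first exact.
  by rewrite addrC [X in _ * X]addrC; apply.
move=> s0 t0; apply: (@le_trans _ _ ((2 * t) ^+ n)).
  by rewrite lerXn2r ?nnegrE ?addr_ge0 ?mulr_ge0//; lra.
by rewrite exprMn ler_wpM2l ?exprn_ge0// lerDl exprn_ge0.
Qed.

(** In the application [t ^ 2] is the current Lyapunov value, [a] its contraction, [l] the linear
    noise term, [s] the size of the scaled noise and [v'] the next value. The Taylor remainder is of
    order [s ^ 2 * (t + s) ^ (2 * n.+1)], which splits into the two monomials. *)
Lemma power_increment n lam L : 0 <= lam -> 0 <= L ->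
  exists2 K : R, 0 <= K & forall t a l s v', 0 <= t -> 0 <= a <= t ^+ 2 -> 0 <= s ->
    `|l| <= lam * t * s -> 0 <= v' <= a + l + L * s ^+ 2 ->
  v' ^+ n.+2 <= a ^+ n.+2 + n.+2%:R * a ^+ n.+1 * l +
     K * (t ^+ (2 * n.+1) * s ^+ 2 + s ^+ (2 * n.+2)).
Proof.
move=> lam0 L0; have [K K0 HK] := ler_exprD_taylor n.
pose mu := lam + L.
have mu0 : 0 <= mu by rewrite addr_ge0.
(* The factors come from [|b| <= mu * s * (t + s)] and [a + |b| <= (1 + mu) * (t + s) ^ 2]; the
   power of [2] comes from splitting [(t + s) ^ (2 * n.+1)]. *)
pose K1 := K * mu ^+ 2 * (1 + mu) ^+ n * 2 ^+ (2 * n.+1).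
have K10 : 0 <= K1 by rewrite !mulr_ge0 ?exprn_ge0 ?addr_ge0.
exists (K1 + n.+2%:R * L) => [|t a l s v' t0 /andP[a0 av] s0 hl /andP[v'0 hv']].
  exact: (addr_ge0 K10 (mulr_ge0 (ler0n _ _) L0)).
pose b := l + L * s ^+ 2.
have bE : `|b| <= mu * (s * (t + s)).
  apply: (le_trans (ler_normD _ _)); rewrite [X in _ + X]ger0_norm ?mulr_ge0 ?sqr_ge0//.
  have ? : 0 <= lam * (s * s) by rewrite !mulr_ge0.
  have ? : 0 <= L * (s * t) by rewrite !mulr_ge0.
  by rewrite /mu; lra.
have ab0 : 0 <= a + b by rewrite /b addrA; exact: le_trans hv'.
have h1 : v' ^+ n.+2 <= (a + b) ^+ n.+2.
  by rewrite lerXn2r ?nnegrE// /b addrA.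
apply: (le_trans h1); apply: (le_trans (HK a b a0 ab0)).
have h2 : K * b ^+ 2 * (a + `|b|) ^+ n <=
    K1 * (t ^+ (2 * n.+1) * s ^+ 2 + s ^+ (2 * n.+2)).
  have b2 : b ^+ 2 <= mu ^+ 2 * (s ^+ 2 * (t + s) ^+ 2).
    rewrite -exprMn -exprMn -(real_normK (num_real b)).
    by rewrite lerXn2r ?nnegrE ?mulr_ge0 ?addr_ge0.
  have ab : (a + `|b|) ^+ n <= (1 + mu) ^+ n * (t + s) ^+ (2 * n).
    rewrite exprM -exprMn lerXn2r ?nnegrE ?addr_ge0 ?mulr_ge0 ?sqr_ge0 ?addr_ge0//.
    have : t ^+ 2 <= (t + s) ^+ 2 by rewrite lerXn2r ?nnegrE ?addr_ge0 ?lerDl.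
    have : mu * (s * (t + s)) <= mu * (t + s) ^+ 2.
      by rewrite ler_wpM2l// expr2 ler_wpM2r ?addr_ge0// lerDr.
    lra.
  have ts := @exprD_le_sum (2 * n.+1) s t s0 t0.
  apply: (@le_trans _ _ (K * (mu ^+ 2 * (s ^+ 2 * (t + s) ^+ 2)) *
      ((1 + mu) ^+ n * (t + s) ^+ (2 * n)))).
    apply: ler_pM => //; [exact: mulr_ge0 K0 (sqr_ge0 b)|
      by rewrite exprn_ge0 ?addr_ge0|by rewrite ler_wpM2l].
  have -> : K * (mu ^+ 2 * (s ^+ 2 * (t + s) ^+ 2)) * ((1 + mu) ^+ n * (t + s) ^+ (2 * n))
    = K * mu ^+ 2 * (1 + mu) ^+ n * s ^+ 2 * (t + s) ^+ (2 * n.+1).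
    by rewrite mulnS exprD; ring.
  have -> : K1 * (t ^+ (2 * n.+1) * s ^+ 2 + s ^+ (2 * n.+2)) =
    K * mu ^+ 2 * (1 + mu) ^+ n * s ^+ 2 *
     (2 ^+ (2 * n.+1) * (t ^+ (2 * n.+1) + s ^+ (2 * n.+1))).
    by rewrite /K1 (mulnS 2 n.+1) (exprD s); ring.
  by rewrite ler_wpM2l// !mulr_ge0 ?sqr_ge0 ?exprn_ge0 ?addr_ge0.
have h3 : n.+2%:R * a ^+ n.+1 * (L * s ^+ 2) <=
    n.+2%:R * L * (t ^+ (2 * n.+1) * s ^+ 2).
  have : a ^+ n.+1 <= t ^+ (2 * n.+1).
    by rewrite exprM lerXn2r ?nnegrE ?sqr_ge0.
  have c0 : 0 <= n.+2%:R * L * s ^+ 2 by rewrite !mulr_ge0 ?sqr_ge0.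
  by move=> /(ler_wpM2l c0); lra.
have h4 : 0 <= n.+2%:R * L * s ^+ (2 * n.+2).
  by apply: mulr_ge0; [exact: mulr_ge0|exact: exprn_ge0].
have h5 : n.+2%:R * a ^+ n.+1 * b =
    n.+2%:R * a ^+ n.+1 * l + n.+2%:R * a ^+ n.+1 * (L * s ^+ 2).
  by rewrite /b mulrDr.
by rewrite h5; move: K1 h2 {K10} => K1; lra.
Qed.

End ScalarEstimates.

(** * Scalar form of one truncated step *)

Section OneStepScalar.
Context (R : realType).

(** For [u = alpha * y], powers decrease in the exponent when [u <= 1] and increase when [u > 1]. In
    the second bound, [y <= 1] yields [alpha ^ 2], [p <= 2] yields [alpha ^ p * y ^ p], and the
    remaining case yields [alpha ^ 2 * y ^ p]. *)
Lemma powR_truncation (p alpha y : R) (n : nat) : 1 < p -> p <= n.+2%:R ->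
  0 < alpha -> alpha <= 1 -> 0 <= y ->
  [/\ alpha ^+ n.+3 <= alpha `^ p,
      alpha * y <= 1 -> (alpha * y) ^+ 2 <=
        alpha ^+ 2 + (alpha ^+ 2 + alpha `^ p) * y `^ p,
      alpha * y <= 1 -> (alpha * y) ^+ (2 * n.+2) <= alpha `^ p * y `^ p &
      1 < alpha * y -> alpha * y <= alpha `^ p * y `^ p].
Proof.
move=> p1 pn a0 a1 y0.
have p0 : p != 0 by rewrite gt_eqF// (lt_trans _ p1).
have ay0 : 0 <= alpha * y by rewrite mulr_ge0// ltW.
have eM : alpha `^ p * y `^ p = (alpha * y) `^ p by rewrite powRM// ltW.
have small k z : 0 <= z -> z <= 1 -> p <= k%:R -> z ^+ k <= z `^ p.
  move=> z0 z1 pk; have [->|zn0] := eqVneq z 0.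
    by rewrite powR0// expr0n; case: k pk => // ; rewrite leNgt (lt_trans _ p1).
  rewrite -powR_mulrn//; apply: ger_powR => //.
  by rewrite lt_def zn0 z0.
split.
- apply: small => //; first exact: ltW.
  by apply: (le_trans pn); rewrite ler_nat.
- move=> ay1; have [y1|y1] := leP y 1.
    have : (alpha * y) ^+ 2 <= alpha ^+ 2.
      by rewrite lerXn2r ?nnegrE ?(ltW a0)// ler_piMr// ltW.
    have : 0 <= (alpha ^+ 2 + alpha `^ p) * y `^ p.
      by rewrite mulr_ge0 ?addr_ge0 ?sqr_ge0 ?powR_ge0.
    lra.
  have [p2|p2] := leP p 2.
    have := small 2%N _ ay0 ay1 p2; rewrite -eM.
    have : 0 <= alpha ^+ 2 * y `^ p by rewrite mulr_ge0 ?sqr_ge0 ?powR_ge0.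
    have : 0 <= alpha ^+ 2 by rewrite sqr_ge0.
    lra.
  have : y ^+ 2 <= y `^ p.
    by rewrite -powR_mulrn//; apply: ler_powR; exact: ltW.
  move=> /(ler_wpM2l (sqr_ge0 alpha)); rewrite exprMn.
  have : 0 <= alpha `^ p * y `^ p by rewrite mulr_ge0 ?powR_ge0.
  have : 0 <= alpha ^+ 2 by rewrite sqr_ge0.
  lra.
- move=> ay1; rewrite eM; apply: small => //.
  by apply: (le_trans pn); rewrite ler_nat leq_pmull.
- move=> ay1; rewrite eM -[leLHS]powRr1//.
  by apply: ler_powR; exact: ltW.
Qed.

(** Here [q] and [yp] stand for [alpha ^ p] and [y ^ p]. The linear term is kept even where the
    truncation makes the left side [0], because it is the untruncated noise that has mean zero; the
    last remainder term compensates for its possibly negative value there. *)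
Lemma truncated_increment n (lam L : R) : 0 <= lam -> 0 <= L ->
  exists2 K : R, 0 <= K & forall t a l v' r alpha y q yp : R, 0 <= t ->
    0 <= a <= t ^+ 2 -> 0 <= r -> 0 <= alpha -> 0 <= y -> 0 <= q -> 0 <= yp ->
    `|l| <= lam * t * (r * (alpha * y)) ->
    0 <= v' <= a + l + L * (r * (alpha * y)) ^+ 2 ->
    (alpha * y <= 1 -> (alpha * y) ^+ 2 <= alpha ^+ 2 + (alpha ^+ 2 + q) * yp) ->
    (alpha * y <= 1 -> (alpha * y) ^+ (2 * n.+2) <= q * yp) ->
    (1 < alpha * y -> alpha * y <= q * yp) ->
  (if alpha * y <= 1 then v' ^+ n.+2 else 0) <=
    a ^+ n.+2 + n.+2%:R * a ^+ n.+1 * l +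
    K * (t ^+ (2 * n.+1) * r ^+ 2 * alpha ^+ 2 +
         (t ^+ (2 * n.+1) * r ^+ 2 * (alpha ^+ 2 + q) + r ^+ (2 * n.+2) * q +
          t ^+ (2 * n.+1) * (t * r) * q) * yp).
Proof.
move=> lam0 L0; have [K K0 HK] := power_increment n lam0 L0.
exists (K + n.+2%:R * lam); first by rewrite addr_ge0 ?(mulr_ge0 (ler0n _ _)).
move=> t a l v' r alpha y q yp t0 at2 r0 al0 y0 q0 yp0 hl hv' h1 h2 h3.
have a0 : 0 <= a by case/andP: at2.
have ay0 : 0 <= alpha * y by rewrite mulr_ge0.
set X := t ^+ (2 * n.+1).
have X0 : 0 <= X by rewrite exprn_ge0.
have X1 : 0 <= X * r ^+ 2 * alpha ^+ 2 by rewrite !mulr_ge0 ?sqr_ge0.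
have X2 : 0 <= X * r ^+ 2 * (alpha ^+ 2 + q) * yp.
  by rewrite !mulr_ge0 ?sqr_ge0 ?addr_ge0 ?sqr_ge0.
have X3 : 0 <= r ^+ (2 * n.+2) * q * yp by exact: mulr_ge0 (mulr_ge0 (exprn_ge0 _ r0) q0) yp0.
have X4 : 0 <= X * (t * r) * q * yp by rewrite !mulr_ge0.
have K20 : 0 <= n.+2%:R * lam by rewrite (mulr_ge0 (ler0n _ _)).
set Z := X * r ^+ 2 * alpha ^+ 2 + _.
have ZE : Z = X * r ^+ 2 * alpha ^+ 2 + X * r ^+ 2 * (alpha ^+ 2 + q) * yp +
   r ^+ (2 * n.+2) * q * yp + X * (t * r) * q * yp by rewrite /Z; ring.
case: ifPn => [ay1|]; last rewrite -ltNge => ay1.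
  have s0 : 0 <= r * (alpha * y) by rewrite mulr_ge0.
  apply: (le_trans (HK t a l _ v' t0 at2 s0 hl hv')); rewrite lerD2l.
  apply: (@le_trans _ _ (K * Z)); last first.
    by rewrite ler_wpM2r ?lerDl// ZE !addr_ge0.
  rewrite ler_wpM2l// -/X !exprMn.
  have := ler_wpM2l (mulr_ge0 X0 (sqr_ge0 r)) (h1 ay1).
  have := ler_wpM2l (exprn_ge0 (2 * n.+2) r0) (h2 ay1).
  rewrite !exprMn ZE; lra.
(* Off the truncation event, [alpha * y <= q * yp] bounds the linear term by a multiple of
   [q * yp]. *)
have : n.+2%:R * a ^+ n.+1 * `|l| <= n.+2%:R * lam * (X * (t * r) * q * yp).
  have aX : a ^+ n.+1 <= X.
    by rewrite /X exprM lerXn2r ?nnegrE ?sqr_ge0//; case/andP: at2.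
  apply: (@le_trans _ _ (n.+2%:R * X * (lam * t * (r * (q * yp))))); last first.
    by rewrite le_eqVlt; apply/orP; left; apply/eqP; ring.
  apply: ler_pM => //; rewrite ?(mulr_ge0 (ler0n _ _)) ?exprn_ge0//.
    by rewrite ler_wpM2l.
  by apply: (le_trans hl); rewrite ler_wpM2l ?mulr_ge0// ler_wpM2l// h3.
have : 0 <= n.+2%:R * a ^+ n.+1 * (`|l| + l).
  rewrite (mulr_ge0 (mulr_ge0 (ler0n _ _) (exprn_ge0 _ _)))//.
  by rewrite -lerBlDr sub0r -normrN ler_norm.
have : 0 <= a ^+ n.+2 by rewrite exprn_ge0.
have : 0 <= K * Z by rewrite mulr_ge0// ZE !addr_ge0.
have : n.+2%:R * lam * (X * (t * r) * q * yp) <= n.+2%:R * lam * Z.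
  by rewrite ler_wpM2l// ZE; lra.
lra.
Qed.

Lemma absorb_remainder n (c kappa K Kp : R) :
  0 < c -> 0 <= kappa -> 0 <= K -> 0 <= Kp ->
  exists delta K' : R, [/\ 0 < delta, 0 <= K' & forall t r alpha q : R,
    0 <= t -> 0 <= r -> r ^+ 2 <= kappa * (1 + t ^+ 2) ->
    0 < alpha -> alpha <= delta -> 0 <= q -> q <= delta * alpha ->
    alpha ^+ n.+3 <= q ->
  K * (t ^+ (2 * n.+1) * r ^+ 2 * alpha ^+ 2 +
     (t ^+ (2 * n.+1) * r ^+ 2 * (alpha ^+ 2 + q) + r ^+ (2 * n.+2) * q +
      t ^+ (2 * n.+1) * (t * r) * q) * Kp) <=
  c * alpha * (t ^+ 2) ^+ n.+2 + K' * q].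
Proof.
move=> c0 k0 K0 Kp0.
pose M := kappa * (1 + Kp) + Kp * (2 * kappa + kappa ^+ n.+2 * 2 ^+ n.+2 + 2 * (1 + kappa)).
have km0 : 0 <= kappa ^+ n.+2 * 2 ^+ n.+2.
  by apply: mulr_ge0; exact: exprn_ge0.
have M20 : 0 <= 2 * kappa + kappa ^+ n.+2 * 2 ^+ n.+2 + 2 * (1 + kappa) by lra.
have M0 : 0 <= M by apply: addr_ge0; apply: mulr_ge0 => //; lra.
have MK0 : 0 <= K * M by rewrite mulr_ge0.
(* Three terms will each cost at most [K * M * delta * alpha * (t ^ 2) ^ n.+2], so
   [3 * K * M * delta <= c] is what is needed; the [+ 1] covers [K * M = 0]. *)
pose delta := c / (3 * (K * M) + 1).
have den0 : 0 < 3 * (K * M) + 1 by lra.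
have d0 : 0 < delta by rewrite divr_gt0.
have dc : 3 * (K * M) * delta <= c.
  rewrite /delta mulrA ler_pdivrMr//; lra.
exists delta, (K * M * (1 + (delta ^+ n.+1)^-1)); split => //.
  by rewrite mulr_ge0// addr_ge0// invr_ge0 exprn_ge0// ltW.
move=> t r alpha q t0 r0 hr al0 ald q0 qd alq.
rewrite !(exprM t) (exprM r).
have v0 : 0 <= t ^+ 2 by rewrite sqr_ge0.
have tr : t * r <= t ^+ 2 + r ^+ 2.
  have := sqr_ge0 (t - r); have := mulr_ge0 t0 r0; rewrite sqrrB; lra.
have rr0 : 0 <= r ^+ 2 by rewrite sqr_ge0.
have tr0 : 0 <= t * r by rewrite mulr_ge0.
move: (t ^+ 2) (r ^+ 2) v0 rr0 hr tr => v rr v0 rr0 hr tr.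
set X := v ^+ n.+1; set Y := v ^+ n.+2.
have X0 : 0 <= X by rewrite exprn_ge0.
have Y0 : 0 <= Y by rewrite exprn_ge0.
have YE : Y = X * v by rewrite /Y exprSr.
have XY : X <= 1 + Y.
  have [v1|v1] := leP v 1.
    have : X <= 1 by rewrite exprn_ile1.
    lra.
  have : X * 1 <= X * v by rewrite ler_wpM2l// ltW.
  rewrite YE; lra.
have Xr : X * rr <= kappa * (X + Y).
  by have := ler_wpM2l X0 hr; rewrite YE; lra.
have rm : rr ^+ n.+2 <= kappa ^+ n.+2 * 2 ^+ n.+2 * (1 + Y).
  apply: (@le_trans _ _ ((kappa * (1 + v)) ^+ n.+2)).
    by rewrite lerXn2r ?nnegrE ?mulr_ge0 ?addr_ge0.
  rewrite exprMn -mulrA ler_wpM2l ?exprn_ge0//.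
  by have := @exprD_le_sum R n.+2 v 1 v0 ler01; rewrite expr1n.
have Xtr : X * (t * r) <= (1 + kappa) * (X + Y).
  have := ler_wpM2l X0 tr; rewrite YE; rewrite YE in Xr; lra.
(* A Young inequality by cases: if [alpha <= delta * v], one factor [alpha] is traded for
   [delta * v]; otherwise [v < alpha / delta], and [alpha ^ 2 * X] is at most
   [alpha ^ (n + 3) / delta ^ (n + 1)]. *)
have aX : alpha ^+ 2 * X <= delta * alpha * Y + (delta ^+ n.+1)^-1 * q.
  have q0' : 0 <= (delta ^+ n.+1)^-1 * q.
    by apply: mulr_ge0 => //; rewrite invr_ge0; apply: exprn_ge0; exact: ltW.
  have Y0' : 0 <= delta * alpha * Y by apply: mulr_ge0 => //; apply: mulr_ge0; exact: ltW.
  have [av|av] := leP alpha (delta * v).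
    have : alpha * X * alpha <= alpha * X * (delta * v).
      by rewrite ler_wpM2l// mulr_ge0// ltW.
    rewrite YE in Y0' *; lra.
  have : X <= (delta ^+ n.+1)^-1 * alpha ^+ n.+1.
    rewrite mulrC ler_pdivlMr ?exprn_gt0// mulrC -exprMn.
    have dv0 : 0 <= delta * v := mulr_ge0 (ltW d0) v0.
    exact: (lerXn2r _ dv0 (ltW al0) (ltW av)).
  move=> /(ler_wpM2l (sqr_ge0 alpha)).
  have : (delta ^+ n.+1)^-1 * alpha ^+ n.+3 <= (delta ^+ n.+1)^-1 * q.
    by rewrite ler_wpM2l// invr_ge0 exprn_ge0// ltW.
  have -> : alpha ^+ n.+3 = alpha ^+ 2 * alpha ^+ n.+1 by rewrite -exprD.
  lra.
have aY : alpha ^+ 2 * Y <= delta * alpha * Y.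
  by rewrite ler_wpM2r// expr2 ler_wpM2r// ltW.
have qY : q * Y <= delta * alpha * Y by rewrite ler_wpM2r.
set Q := X * rr * alpha ^+ 2 + _.
have QM : Q <= M * (alpha ^+ 2 * X + alpha ^+ 2 * Y + q * (1 + Y)).
  have al2 : 0 <= alpha ^+ 2 by rewrite sqr_ge0.
  have e1 := ler_wpM2r al2 Xr.
  have e2 := ler_wpM2r q0 Xr.
  have e3 := ler_wpM2r q0 rm.
  have e4 := ler_wpM2r q0 Xtr.
  have e5 : q * X <= q * (1 + Y) by rewrite ler_wpM2l.
  have e6 := ler_wpM2l k0 e5.
  have kM := exprn_ge0 n.+2 k0.
  have e1' := ler_wpM2r Kp0 e1.
  have e7 : (X * rr * (alpha ^+ 2 + q) + rr ^+ n.+2 * q + X * (t * r) * q) <=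
     kappa * (X + Y) * alpha ^+ 2 +
     (2 * kappa + kappa ^+ n.+2 * 2 ^+ n.+2 + 2 * (1 + kappa)) * (q * (1 + Y)).
    have : 0 <= kappa * q by rewrite mulr_ge0.
    lra.
  have e8 := ler_wpM2r Kp0 e7.
  have p1 : 0 <= kappa * (1 + Kp) * (q * (1 + Y)).
    by apply: mulr_ge0; apply: mulr_ge0 => //; lra.
  have p2 : 0 <= Kp * (2 * kappa + kappa ^+ n.+2 * 2 ^+ n.+2 + 2 * (1 + kappa)) *
      (alpha ^+ 2 * X + alpha ^+ 2 * Y).
    apply: mulr_ge0; first exact: mulr_ge0.
    by apply: addr_ge0; exact: mulr_ge0.
  rewrite /Q /M; lra.
apply: (le_trans (ler_wpM2l K0 QM)); rewrite mulrA.
apply: (@le_trans _ _ (K * M * (3 * delta * (alpha * Y) + (1 + (delta ^+ n.+1)^-1) * q))).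
  by rewrite ler_wpM2l//; lra.
have : 3 * (K * M) * delta * (alpha * Y) <= c * (alpha * Y).
  by rewrite ler_wpM2r// mulr_ge0// ltW.
lra.
Qed.

End OneStepScalar.

(** * Measurability of functions of random vectors *)

Section ContinuousMeasurable.
Context (R : realType) (d : nat).

(** Rounding each coordinate down to the grid of mesh [1 / (n + 1)] makes [f] of the rounded point a
    function of an integer vector, so its preimages are countable unions of measurable sets. By
    continuity of [f] these functions converge pointwise. *)
Lemma measurable_continuous_comp (d0 : measure_display) (T : measurableType d0)
    (f : 'rV[R]_d -> R) (x : T -> 'rV[R]_d) :
  continuous f -> (forall i, measurable_fun setT (fun om => x om 0 i)) ->
  measurable_fun setT (fun om => f (x om)).
Proof.
move=> cf mx.
pose c n : R := n.+1%:R.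
have c0 n : 0 < c n by rewrite ltr0n.
pose fl n om : 'rV[int]_d := \row_i Num.floor (c n * x om 0 i).
pose pt n (v : 'rV[int]_d) : 'rV[R]_d := \row_i ((v 0 i)%:~R / c n).
apply: (@measurable_fun_cvg _ _ _ _ (fun n om => f (pt n (fl n om)))).
- move=> n _ B mB; rewrite setTI.
  have -> : (fun om => f (pt n (fl n om))) @^-1` B =
      \bigcup_(v : 'rV[int]_d) ([set _ | f (pt n v) \in B] `&`
        \bigcap_(i : 'I_d) [set om | Num.floor (c n * x om 0 i) == v 0 i]).
    apply/seteqP; split => om /=.
      move=> Bf; exists (fl n om) => //; split; first exact: mem_set.
      by move=> i _ /=; rewrite mxE.
    move=> [v _ [/set_mem Bv hv]].
    suff -> : fl n om = v by [].
    by apply/rowP => i; rewrite mxE; apply/eqP; exact: hv.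
  apply: countable_bigcupT_measurable; first exact: countableP.
  move=> v; apply: measurableI.
    have [fB|fB] := boolP (f (pt n v) \in B).
      by rewrite (_ : [set _ | _] = setT)//; apply/seteqP; split.
    by rewrite (_ : [set _ | _] = set0)//; apply/seteqP; split.
  apply: fin_bigcap_measurable => // i _.
  have mcx : measurable_fun setT (fun om => c n * x om 0 i) by exact: measurable_funM.
  have := mcx measurableT _ (measurable_itv `[(v 0 i)%:~R, (v 0 i + 1)%:~R[).
  rewrite setTI; congr (measurable _); apply/seteqP; split => om /=.
    by rewrite in_itv/= floor_eq.
  by rewrite floor_eq in_itv.
- move=> om _; apply: (cvg_comp _ f _ (cf (x om))).
  apply/cvg_ballP => e e0.
  have [N _ hN] := near_infty_natSinv_lt (PosNum e0).
  exists N => // n /= /hN /= ne; split=> // i0 i; rewrite (ord1 i0) !mxE.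
  rewrite /ball/= ltr_norml.
  have /andP[f1 f2] := floor_itv (c n * x om 0 i).
  have -> : x om 0 i - (Num.floor (c n * x om 0 i))%:~R / c n =
      (c n * x om 0 i - (Num.floor (c n * x om 0 i))%:~R) / c n.
    by field; rewrite gt_eqF.
  rewrite intrD in f2.
  apply/andP; split.
    by apply: (@lt_le_trans _ _ 0); rewrite ?oppr_lt0// divr_ge0 ?(ltW (c0 _))//; lra.
  apply: le_lt_trans ne; rewrite ler_pdivrMr// mulVf ?gt_eqF//; lra.
Qed.

(** A partial derivative is the pointwise limit of difference quotients with steps [1 / (n + 1)], so
    differentiability suffices and the gradient may be discontinuous. *)
Lemma measurable_grad (d0 : measure_display) (T : measurableType d0)
    (f : 'rV[R]_d -> R) (x : T -> 'rV[R]_d) (i : 'I_d) :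
  (forall y, differentiable f y) ->
  (forall i, measurable_fun setT (fun om => x om 0 i)) ->
  measurable_fun setT (fun om => grad f (x om) 0 i).
Proof.
move=> df mx; pose h n : R := n.+1%:R^-1.
pose e : 'rV[R]_d := delta_mx 0 i.
apply: (@measurable_fun_cvg _ _ _ _
  (fun n om => (h n)^-1 * (f (h n *: e + x om) - f (x om)))).
- move=> n; apply: measurable_funM => //; apply: measurable_funB.
    apply: (@measurable_continuous_comp _ _ f (fun om => h n *: e + x om)).
      by move=> y; exact/differentiable_continuous.
    move=> j; under eq_fun do rewrite mxE.
    by apply: measurable_funD.
  by apply: measurable_continuous_comp => // y; exact/differentiable_continuous.
- move=> om _; rewrite mxE -deriveE//.
  have /cvgr_dnbhsP/(_ (fun n => h n)) : (fun k : R =>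
      k^-1 *: ((f \o shift (x om)) (k *: e) - f (x om))) @ 0^' --> 'D_e f (x om).
    exact: diff_derivable.
  apply; split; last exact: cvg_harmonic.
  by move=> n; rewrite invr_eq0 pnatr_eq0.
Qed.

End ContinuousMeasurable.

Section VectorMeasurability.
Context (R : realType) (d : nat) (d0 : measure_display) (T : measurableType d0).

Lemma measurable_enorm (x : T -> 'rV[R]_d) :
  (forall i, measurable_fun setT (fun om => x om 0 i)) ->
  measurable_fun setT (fun om => enorm (x om)).
Proof.
move=> mx; apply: (@measurableT_comp _ _ _ _ _ _ (@Num.sqrt R)).
  by apply: continuous_measurable_fun; exact: sqrt_continuous.
apply: measurable_sum => i; exact: measurable_funM.
Qed.

Lemma lipschitz_coord_continuous (H : 'rV[R]_d -> 'rV[R]_d) (C : R) i :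
  0 < C -> (forall y z, enorm (H y - H z) <= C * enorm (y - z)) ->
  continuous (fun y => H y 0 i).
Proof.
move=> C0 lipH y; apply/(@cvgrPdist_lt _ _ _ (nbhs y)) => e e0.
(* The neighbourhood is a cube, on which the Euclidean norm is at most [d] times the half-side;
   [d.+1] keeps the quotient meaningful for [d = 0] and makes the last inequality strict. *)
pose dl := e / (C * d.+1%:R).
have dl0 : 0 < dl by rewrite divr_gt0// mulr_gt0// ltr0n.
exists (fun i j => ball (y i j) dl) => [i0 j|z yz /=]; first exact: nbhsx_ballx.
have hz j : `|(y - z) 0 j| <= dl.
  by rewrite !mxE; exact/ltW/(yz 0 j).
have := coord_le_enorm (H y - H z) i; rewrite !mxE => h.
apply: (le_lt_trans h); apply: (le_lt_trans (lipH _ _)).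
apply: (@le_lt_trans _ _ (C * (d%:R * dl))).
  rewrite ler_wpM2l ?(ltW C0)//; apply: (le_trans (enorm_le_sum _)).
  apply: le_trans (ler_sum _ (fun j _ => hz j)) _.
  by rewrite sumr_const card_ord mulr_natl.
have -> : C * (d%:R * dl) = e * (d%:R / d.+1%:R).
  by rewrite /dl; field; rewrite (gt_eqF C0) nat1r pnatr_eq0.
by rewrite gtr_pMr// ltr_pdivrMr ?ltr0n// mul1r ltr_nat.
Qed.

End VectorMeasurability.

(** * Averaging a pointwise one-step inequality *)

Section ConditionalMean.
Context (d0 : measure_display) (T : measurableType d0) (R : realType).
Variables (P : probability T R) (G : set (set T)).
Hypothesis GT : G `<=` measurable.
Local Notation TG := (g_sigma_algebraType G).

Lemma integral_indicM (A : set T) (f : T -> R) :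
  (\int[P]_(x in A) (f x)%:E = \int[P]_x (\1_A x * f x)%:E)%E.
Proof.
rewrite integral_mkcond; apply: eq_integral => x _; rewrite /patch indicE.
by case: (x \in A); rewrite ?mul1r ?mul0r.
Qed.

Lemma integrable_le_cst (f : T -> R) (B : R) : measurable_fun [set: T] f ->
  (forall x, `|f x| <= B) -> P.-integrable [set: T] (EFin \o f).
Proof.
move=> mf fB; apply: measurable_bounded_integrable => //.
  by rewrite -ge0_fin_numE// fin_num_measure.
exists B; split; first exact: num_real.
by move=> z Bz x _; apply: le_trans (ltW Bz).
Qed.

(** On averaging [X <= Y + Q * u + <g, w>], the noise term vanishes since [g] is bounded and known
    at the current time, and [u] may be replaced by its conditional bound [h] under the weight
    [Q]. *)
Lemma conditional_mean_bound d (X Y Q u h : T -> R) (g w : 'I_d -> T -> R) (B : R) :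
  (forall x, 0 <= X x) -> (forall x, 0 <= Y x) -> (forall x, 0 <= Q x) ->
  (forall x, 0 <= u x) -> (forall x, 0 <= h x) ->
  measurable_fun [set: T] X -> measurable_fun [set: T] Y ->
  measurable_fun [set: TG] (Q : TG -> R) ->
  measurable_fun [set: T] u -> measurable_fun [set: T] h ->
  (forall i, measurable_fun [set: TG] (g i : TG -> R)) ->
  (forall i x, `|g i x| <= B) ->
  (forall x, Y x + Q x * h x <= B) ->
  (forall i, P.-integrable [set: T] (EFin \o w i)) ->
  (forall i A, <<s G >> A -> (\int[P]_(x in A) (w i x)%:E = 0)%E) ->
  (forall A, <<s G >> A ->
     (\int[P]_(x in A) (u x)%:E <= \int[P]_(x in A) (h x)%:E)%E) ->
  (forall x, X x <= Y x + Q x * u x + \sum_(i < d) g i x * w i x) ->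
  (\int[P]_x (X x)%:E <= \int[P]_x (Y x + Q x * h x)%:E)%E.
Proof.
move=> X0 Y0 Q0 u0 h0 mX mY mQ mu mh mg gB YB wi w0 uh XY.
have mQT := measurable_fun_g_sigma GT mQ.
have Qh0 x : 0 <= Q x * h x by rewrite mulr_ge0.
have Qu0 x : 0 <= Q x * u x by rewrite mulr_ge0.
have mQh : measurable_fun [set: T] (fun x => Q x * h x) by exact: measurable_funM.
have mQu : measurable_fun [set: T] (fun x => Q x * u x) by exact: measurable_funM.
have Yi : P.-integrable [set: T] (EFin \o Y).
  by apply: (integrable_le_cst mY (B := B)) => x; rewrite ger0_norm//; have := YB x; have := Qh0 x; lra.
have Qhi : P.-integrable [set: T] (fun x => (Q x * h x)%:E).
  by apply: (integrable_le_cst mQh (B := B)) => x; rewrite ger0_norm//; have := YB x; have := Y0 x; lra.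
have QuQh : (\int[P]_x (Q x * u x)%:E <= \int[P]_x (Q x * h x)%:E)%E.
  exact: (@le_weighted_integral _ _ _ _ _ GT).
(* Integrability of [Q * u] comes from the comparison with the bounded [Q * h]. *)
have Qui : P.-integrable [set: T] (fun x => (Q x * u x)%:E).
  apply/integrableP; split; first exact/measurable_EFinP.
  under eq_integral do rewrite gee0_abs ?lee_fin//.
  apply: (le_lt_trans QuQh).
  by have := integrable_lty measurableT Qhi.
have gwi i : P.-integrable [set: T] (fun x => (g i x * w i x)%:E).
  have bg : [bounded g i x | x in [set: T]].
    exists B; split; first exact: num_real.
    by move=> z Bz x _; apply: le_trans (ltW Bz).
  exact: (integrableMr measurableT (measurable_fun_g_sigma GT (mg i)) bg (wi i)).
have gw0 i : (\int[P]_x (g i x * w i x)%:E = 0)%E.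
  exact: (weighted_integral0 GT (gB i) (mg i) (wi i) (w0 i)).
pose S x := (\sum_(i < d) (g i x * w i x)%:E)%E.
have Si : P.-integrable [set: T] S by exact: integrable_sum.
have S0 : (\int[P]_x S x = 0)%E.
  by rewrite integral_sum// big1.
have YQi : P.-integrable [set: T] (fun x => (Y x)%:E + (Q x * u x)%:E)%E.
  exact: integrableD.
have Ri : P.-integrable [set: T] (fun x => (Y x)%:E + (Q x * u x)%:E + S x)%E.
  exact: integrableD.
have XR x : ((X x)%:E <= (Y x)%:E + (Q x * u x)%:E + S x)%E.
  by rewrite /S sumEFin -!EFinD lee_fin.
apply: (@le_trans _ _ (\int[P]_x ((Y x)%:E + (Q x * u x)%:E + S x))%E).
  apply: ge0_le_integral => //.
  - by move=> x _; rewrite lee_fin.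
  - exact/measurable_EFinP.
  - exact: measurable_int Ri.
rewrite integralD// S0 adde0 integralD//.
under [leRHS]eq_integral do rewrite EFinD.
by rewrite integralD// leeD2l.
Qed.

End ConditionalMean.

(** * Tails of nonnegative series *)

Section Series.
Context (R : realType).

Lemma nneseries_tail_small (b : nat -> R) : (forall k, 0 <= b k) ->
  (\sum_(0 <= k <oo) (b k)%:E < +oo)%E ->
  forall e, 0 < e -> exists n, forall K, \sum_(n <= k < K) b k < e.
Proof.
move=> b0 bfin e e0.
have be0 k : true -> (0 <= (b k)%:E)%E by rewrite lee_fin.
have e0' : (0 < e%:E)%E by rewrite lte_fin.
have [n _ /(_ n (leqnn n)) /= hn] :=
  nneseries_tail_cvg bfin be0 (open_ereal_lt' e0').
exists n => K.
rewrite -lte_fin; apply: le_lt_trans hn; rewrite -sumEFin.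
by apply: nneseries_lim_ge => k _ _; rewrite lee_fin.
Qed.

Lemma nneseries_unbounded (a : nat -> R) : (forall k, 0 <= a k) ->
  (\sum_(0 <= k <oo) (a k)%:E = +oo)%E ->
  forall M n, exists K, M <= \sum_(n <= k < K) a k.
Proof.
move=> a0 ay M n; apply: contrapT => noK.
have : (\sum_(0 <= k <oo) (a k)%:E <= (\sum_(0 <= k < n) a k + M)%:E)%E.
  apply: lime_le; first by apply: is_cvg_nneseries => k _ _; rewrite lee_fin.
  exists n => // K /= nK; rewrite sumEFin lee_fin.
  rewrite (@big_cat_nat _ _ _ n)//= lerD2l leNgt; apply/negP => MK.
  by apply: noK; exists K; exact: ltW.
by rewrite ay leye_eq.
Qed.

Lemma summable_powR_small (alpha : nat -> R) (p : R) : 1 < p ->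
  (forall k, 0 < alpha k) ->
  (\sum_(0 <= k <oo) (alpha k `^ p)%:E < +oo)%E ->
  forall delta, 0 < delta -> exists N, forall k, (N <= k)%N ->
    alpha k <= delta /\ alpha k `^ p <= delta * alpha k.
Proof.
move=> p1 al0 alp delta d0.
have p0 : 0 <= p by exact: le_trans ler01 (ltW p1).
(* A tail sum below [dl ^ p] forces [alpha k <= dl]. The second bound then follows from
   [alpha ^ p = alpha ^ (p - 1) * alpha], as [dl ^ (p - 1) <= delta]. *)
pose dl := Num.min delta (delta `^ (p - 1)^-1).
have dl0 : 0 < dl by rewrite lt_min d0 powR_gt0.
have [N hN] := nneseries_tail_small (fun k => powR_ge0 (alpha k) p) alp
  (powR_gt0 p dl0).
exists N => k Nk.
have ak : alpha k <= dl.
  rewrite leNgt; apply/negP => h.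
  have : dl `^ p <= alpha k `^ p.
    by apply: ge0_ler_powR => //; rewrite ?nnegrE; exact: ltW.
  have := hN k.+1; rewrite big_nat_recr//=.
  have : 0 <= \sum_(N <= i < k) alpha i `^ p.
    by apply: sumr_ge0 => i _; exact: powR_ge0.
  lra.
move: ak; rewrite le_min => /andP[a1 a2]; split => //.
have -> : alpha k `^ p = alpha k `^ (p - 1) * alpha k.
  rewrite -[X in _ * X]powRr1 ?(ltW (al0 k))// -powRD ?subrK//.
  by apply/implyP => _; rewrite gt_eqF.
rewrite ler_wpM2r ?(ltW (al0 k))//.
have -> : delta = (delta `^ (p - 1)^-1) `^ (p - 1).
  by rewrite -powRrM mulVf ?powRr1 ?ltW// subr_eq0 gt_eqF.
by rewrite ge0_ler_powR ?nnegrE ?powR_ge0 ?(ltW (al0 k))// subr_ge0 ltW.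
Qed.

End Series.

(** * The iteration: filtration, measurability and descent *)

Section StochasticApproximation.
Context (R : realType) (d : nat) (d0 : measure_display) (T : measurableType d0)
  (P : probability T R) (H : 'rV[R]_d -> 'rV[R]_d) (x0 : 'rV[R]_d)
  (alpha : nat -> R) (w : nat -> T -> 'rV[R]_d) (p : R) (xstar : 'rV[R]_d)
  (Phi : 'rV[R]_d -> R) (eta c1 c2 L2 Ap Bp C : R).
Hypothesis p1 : 1 < p.
Hypothesis alpha0 : forall k, 0 < alpha k.
Hypothesis mw : forall k (i : 'I_d), measurable_fun setT (fun om => w k om 0 i).
Hypothesis Hstar : H xstar = xstar.
Hypothesis Phi0 : forall y, 0 <= Phi y.
Hypothesis dPhi : forall y, differentiable Phi y.
Hypothesis eta0 : 0 < eta.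
Hypothesis c10 : 0 < c1.
Hypothesis c20 : 0 < c2.
Hypothesis L20 : 0 < L2.
Hypothesis driftH : forall y,
  inner (grad Phi (y - xstar)) (H y - y) <= - eta * Phi (y - xstar).
Hypothesis smooth : forall y z,
  Phi z <= Phi y + inner (grad Phi y) (z - y) + L2 / 2 * enorm (z - y) ^+ 2.
Hypothesis Phi_ge : forall y, c1 * enorm (y - xstar) ^+ 2 <= Phi (y - xstar).
Hypothesis Phi_le : forall y, Phi (y - xstar) <= c2 * enorm (y - xstar) ^+ 2.
Hypothesis C0 : 0 < C.
Hypothesis lipH : forall y z, enorm (H y - H z) <= C * enorm (y - z).

Local Notation x := (sa_iter H alpha w x0).

(** Only the generators of [filtr x k], which is then [<<s G k >>]; inclusions need to be checked on
    these preimages alone. *)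
Let G k : set (set T) :=
  [set A | exists j : nat, exists i : 'I_d, exists B : set R,
     [/\ (j <= k)%N, measurable B & A = (fun om => x j om 0 i) @^-1` B]].
Local Notation TG k := (g_sigma_algebraType (G k)).

Let z k om := x k om - xstar.
Let V k om := Phi (z k om).
Let r k om := 1 + enorm (z k om).
Let E k := [set om | alpha k * (enorm (w k om) / r k om) <= 1].

Lemma measurable_sa_iter k i : measurable_fun [set: T] (fun om => x k om 0 i).
Proof.
elim: k i => [|k ih] i; first exact: measurable_cst.
rewrite [X in measurable_fun _ X](_ : _ = (fun om => x k om 0 i +
    alpha k * (H (x k om) 0 i - x k om 0 i + w k om 0 i))); last first.
  by apply/funext => om; rewrite /= !mxE.
apply: measurable_funD => //; apply: measurable_funM => //.
apply: measurable_funD => //; apply: measurable_funB => //.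
apply: (measurable_continuous_comp (f := fun y => H y 0 i)) => //.
exact: (lipschitz_coord_continuous C0 lipH).
Qed.

Let GT k : G k `<=` measurable.
Proof.
move=> A [j [i [B [jk mB ->]]]]; rewrite -[X in measurable X]setTI.
exact: measurable_sa_iter.
Qed.

Let Gmono k : G k `<=` G k.+1.
Proof.
move=> A [j [i [B [jk mB AE]]]]; exists j, i, B; split => //.
exact: leq_trans jk (leqnSn k).
Qed.

Let mxG j k i : (j <= k)%N -> measurable_fun [set: TG k] (fun om => x j om 0 i).
Proof.
move=> jk _ B mB; rewrite setTI; apply: sub_gen_smallest.
by exists j, i, B.
Qed.

Let mzG j k i : (j <= k)%N -> measurable_fun [set: TG k] (fun om => z j om 0 i).
Proof.
move=> jk; rewrite [X in measurable_fun _ X](_ : _ = (fun om => x j om 0 i - xstar 0 i)).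
  by apply: measurable_funB => //; exact: mxG.
by apply/funext => om; rewrite /z !mxE.
Qed.

Let mVG k : measurable_fun [set: TG k] (V k).
Proof.
apply: (@measurable_continuous_comp _ _ _ (TG k) Phi (z k)).
  by move=> y; exact: differentiable_continuous.
by move=> i; exact: mzG.
Qed.

Let mrG j k : (j <= k)%N -> measurable_fun [set: TG k] (r j).
Proof.
move=> jk; apply: measurable_funD => //.
by apply: (@measurable_enorm _ _ _ (TG k) (z j)) => i; exact: mzG.
Qed.

Let mgradG k i : measurable_fun [set: TG k] (fun om => grad Phi (z k om) 0 i).
Proof.
by apply: (@measurable_grad _ _ _ (TG k) Phi (z k)) => // j; exact: mzG.
Qed.

Let r1 k om : 1 <= r k om.
Proof. by rewrite lerDl enorm_ge0. Qed.

Let r0 k om : 0 < r k om.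
Proof. exact: lt_le_trans (r1 k om). Qed.

Let zV k om : enorm (z k om) ^+ 2 <= V k om / c1.
Proof. by rewrite ler_pdivlMr// mulrC; exact: Phi_ge. Qed.

Lemma sa_iterS k om :
  z k.+1 om = z k om + alpha k *: (H (x k om) - x k om + w k om).
Proof. by rewrite /z /=; rewrite addrAC. Qed.

Lemma enorm_drift y : enorm (H y - y) <= (C + 1) * enorm (y - xstar).
Proof.
have -> : H y - y = (H y - H xstar) + -1 *: (y - xstar).
  by rewrite Hstar scaleN1r; apply/rowP => i; rewrite !mxE; ring.
apply: (le_trans (ler_enormD _ _)).
rewrite enormZ normrN1; have := lipH y xstar; lra.
Qed.

(** A gradient step of length [1 / L2] lowers [Phi] by at least [|grad|^2 / (2 * L2)], and [Phi]
    cannot become negative. *)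
Lemma enorm_grad y : enorm (grad Phi y) <= Num.sqrt (2 * L2) * Num.sqrt (Phi y).
Proof.
have L20' := ltW L20.
rewrite -sqrtrM ?mulr_ge0// -(@ler_pXn2r _ 2)// ?nnegrE ?enorm_ge0 ?sqrtr_ge0//.
rewrite [leRHS]sqr_sqrtr ?mulr_ge0//.
have := smooth y (y + (- L2^-1) *: grad Phi y).
rewrite [y + _ - y]addrC addKr innerZr enormZ exprMn enorm_sqr normrN.
rewrite ger0_norm ?invr_ge0//.
have := Phi0 (y + - L2^-1 *: grad Phi y).
set g := inner _ _ => h1 h2.
have : 0 <= L2 * (Phi y + - L2^-1 * g + L2 / 2 * (L2^-1 ^+ 2 * g)).
  by apply: mulr_ge0 => //; lra.
rewrite (_ : L2 * _ = L2 * Phi y - g / 2); first lra.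
by field; rewrite gt_eqF.
Qed.

(** The square of the full increment is split between [H x - x] and the noise. The first part is at
    most a multiple of [alpha ^ 2 * V], and the step size condition lets half of the drift [eta] pay
    for it. *)
Lemma descent k om : alpha k * (L2 * (C + 1) ^+ 2 / c1) <= eta / 2 ->
  V k.+1 om <= (1 - eta / 2 * alpha k) * V k om +
    alpha k * inner (grad Phi (z k om)) (w k om) + L2 * (alpha k * enorm (w k om)) ^+ 2.
Proof.
move=> ak; apply: (le_trans (smooth (z k om) (z k.+1 om))).
rewrite sa_iterS [z k om + _ - _]addrC addKr innerZr innerDr enormZ.
set u := H _ - _; set wk := w k om.
have h1 : inner (grad Phi (z k om)) u <= - eta * V k om by exact: driftH.
have h2 : enorm (u + wk) ^+ 2 <= 2 * enorm u ^+ 2 + 2 * enorm wk ^+ 2.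
  apply: (@le_trans _ _ ((enorm u + enorm wk) ^+ 2)).
    by rewrite lerXn2r ?nnegrE ?addr_ge0 ?enorm_ge0// ler_enormD.
  have := sqr_ge0 (enorm u - enorm wk); rewrite sqrrB sqrrD; lra.
have h3 : enorm u ^+ 2 <= (C + 1) ^+ 2 * (V k om / c1).
  apply: (@le_trans _ _ ((C + 1) ^+ 2 * enorm (z k om) ^+ 2)).
    rewrite -exprMn lerXn2r ?nnegrE ?enorm_ge0 ?enorm_drift//.
    by rewrite mulr_ge0 ?enorm_ge0 ?addr_ge0 ?ltW.
  by rewrite ler_wpM2l ?sqr_ge0.
rewrite ger0_norm ?(ltW (alpha0 k))// !exprMn.
have h1' := ler_wpM2l (ltW (alpha0 k)) h1.
have a2 : 0 <= L2 / 2 * alpha k ^+ 2 by rewrite mulr_ge0 ?sqr_ge0// divr_ge0 ?ltW.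
have h2' := ler_wpM2l a2 h2.
have h3' := ler_wpM2l a2 h3.
have V0 : 0 <= alpha k * V k om := mulr_ge0 (ltW (alpha0 k)) (Phi0 _).
have h4 := ler_wpM2r V0 ak.
have : L2 / 2 * alpha k ^+ 2 * ((C + 1) ^+ 2 * (V k om / c1)) =
  alpha k * (L2 * (C + 1) ^+ 2 / c1) * (alpha k * V k om) / 2 by ring.
rewrite -/(V k om); lra.
Qed.

(** * Noise moments, the truncation event and the drift of the truncated process *)

Hypothesis wi : forall k (i : 'I_d),
  P.-integrable setT (fun om => (w k om 0 i)%:E).
Hypothesis w0 : forall k (i : 'I_d) (A : set T), filtr x k A ->
  (\int[P]_(om in A) (w k om 0 i)%:E = 0)%E.
Hypothesis Ap0 : 0 < Ap.
Hypothesis Bp0 : 0 <= Bp.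
Hypothesis wp : forall k (A : set T), filtr x k A ->
  (\int[P]_(om in A) (enorm (w k om) `^ p)%:E
    <= \int[P]_(om in A) (Ap + Bp * enorm (x k om - xstar) `^ p)%:E)%E.

(** The noise [w k] is a function of [x k] and [x (k + 1)], by solving the recursion for it, hence
    known at time [k + 1]. *)
Let GE k : <<s G k.+1 >> (E k).
Proof.
pose u om := (alpha k)^-1 *: (z k.+1 om - z k om) - (H (x k om) - x k om).
have uE om : u om = w k om.
  rewrite /u sa_iterS [z k om + _ - _]addrC addKr scalerA mulVf ?gt_eqF// scale1r.
  by rewrite [_ + w k om]addrC addrK.
have mu i : measurable_fun [set: TG k.+1] (fun om => u om 0 i).
  rewrite [X in measurable_fun _ X](_ : _ = (fun om => (alpha k)^-1 *
      (z k.+1 om 0 i - z k om 0 i) - (H (x k om) 0 i - x k om 0 i))); last first.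
    by apply/funext => om; rewrite /u !mxE.
  apply: measurable_funB; last apply: measurable_funB.
  - apply: measurable_funM => //.
    by apply: measurable_funB; apply: mzG.
  - apply: (@measurable_continuous_comp _ _ _ (TG k.+1) (fun y => H y 0 i) (x k)).
      exact: (lipschitz_coord_continuous C0 lipH).
    by move=> j; exact: mxG.
  - exact: mxG.
have mq : measurable_fun [set: TG k.+1]
    (fun om => alpha k * (enorm (u om) * r k om `^ (- 1))).
  apply: measurable_funM => //; apply: measurable_funM.
    exact: (@measurable_enorm _ _ _ (TG k.+1) u).
  by apply: (measurableT_comp (measurable_powR _)); exact: mrG.
have := mq measurableT _ (measurable_itv `]-oo, 1]).
rewrite setTI; congr (<<s G k.+1 >> _); apply/seteqP; split => om /=.
  by rewrite in_itv/= uE powR_inv1 ?(ltW (r0 _ _)).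
by rewrite in_itv/= uE powR_inv1 ?(ltW (r0 _ _)).
Qed.

Let mz j i : measurable_fun [set: T] (fun om => z j om 0 i).
Proof. exact: (measurable_fun_g_sigma (@GT j) (@mzG j j i (leqnn j))). Qed.

Let mwn k : measurable_fun [set: T] (fun om => enorm (w k om)).
Proof. by apply: measurable_enorm => i; exact: mw. Qed.

Let mh k : measurable_fun [set: T] (fun om => Ap + Bp * enorm (z k om) `^ p).
Proof.
apply: measurable_funD => //; apply: measurable_funM => //.
by apply: (measurableT_comp (measurable_powR _)); exact: measurable_enorm.
Qed.

Let mrp k : measurable_fun [set: TG k] (fun om => r k om `^ (- p)).
Proof. by apply: (measurableT_comp (measurable_powR _)); exact: mrG. Qed.

Let powR_ratio k om :
  (enorm (w k om) / r k om) `^ p = r k om `^ (- p) * enorm (w k om) `^ p.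
Proof.
rewrite powRM ?enorm_ge0 ?invr_ge0 ?(ltW (r0 _ _))// mulrC.
by rewrite -powR_inv1 ?(ltW (r0 _ _))// -powRrM mulN1r.
Qed.

Let powR_ge1 u : 1 <= u -> 1 <= u `^ p.
Proof.
by move=> u1; rewrite -[X in X <= _](powRr0 u) ler_powR// (le_trans ler01 (ltW p1)).
Qed.

(** Measured relative to [r], the noise has a conditional [p]-th moment bounded by a constant. *)
Let moment_le k om : r k om `^ (- p) * (Ap + Bp * enorm (z k om) `^ p) <= Ap + Bp.
Proof.
have pp : 0 <= p by rewrite (le_trans _ (ltW p1)).
rewrite powRN mulrC ler_pdivrMr ?powR_gt0//.
have rp1 : 1 <= r k om `^ p.
  exact: powR_ge1.
have : enorm (z k om) `^ p <= r k om `^ p.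
  by rewrite ge0_ler_powR ?nnegrE ?enorm_ge0 ?(ltW (r0 _ _))// lerDr.
move=> /(ler_wpM2l Bp0); have := ler_wpM2l (ltW Ap0) rp1; lra.
Qed.

(** Markov's inequality for the [p]-th power, with the weight [alpha ^ p * r ^ (- p)] known at time
    [k], so that [le_weighted_integral] brings in the moment assumption. *)
Lemma escape_prob k : (P (~` E k) <= ((Ap + Bp) * alpha k `^ p)%:E)%E.
Proof.
have mE : measurable (~` E k).
  exact: measurableC (measurable_g_sigma (@GT k.+1) (@GE k)).
have pp : 0 <= p by rewrite (le_trans _ (ltW p1)).
pose g om := alpha k `^ p * r k om `^ (- p).
have g0 om : 0 <= g om by rewrite mulr_ge0 ?powR_ge0.
have mg : measurable_fun [set: TG k] g by exact: measurable_funM.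
have mgT := measurable_fun_g_sigma (@GT k) mg.
have mwp : measurable_fun [set: T] (fun om => enorm (w k om) `^ p).
  exact: (measurableT_comp (measurable_powR _)).
have ip : (P (~` E k) = \int[P]_om (\1_(~` E k) om)%:E)%E.
  by rewrite integral_indic// setIT.
rewrite ip; apply: (@le_trans _ _ (\int[P]_om (g om * enorm (w k om) `^ p)%:E)%E).
  apply: ge0_le_integral => //.
  - exact/measurable_EFinP/measurable_indic.
  - exact/measurable_EFinP/measurable_funM.
  - move=> om _; rewrite lee_fin indicE.
    have [/set_mem /= Eom|_] := boolP (om \in _); last first.
      by rewrite mulr_ge0 ?powR_ge0.
    have ay : 1 < alpha k * (enorm (w k om) / r k om) by rewrite ltNge; exact/negP.
    rewrite /g -mulrA -powR_ratio -powRM ?(ltW (alpha0 k)) ?divr_ge0 ?enorm_ge0//.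
      exact/powR_ge1/ltW.
    exact: ltW.
have h0 om : 0 <= Ap + Bp * enorm (z k om) `^ p.
  by rewrite addr_ge0 ?(ltW Ap0)// mulr_ge0 ?powR_ge0.
apply: (@le_trans _ _ (\int[P]_om (g om * (Ap + Bp * enorm (z k om) `^ p))%:E)%E).
  apply: (@le_weighted_integral _ _ _ _ _ (@GT k)) => //.
    by move=> om; rewrite powR_ge0.
  by move=> A GA; exact: wp.
apply: (@le_trans _ _ (\int[P]_om ((Ap + Bp) * alpha k `^ p)%:E)%E).
  apply: ge0_le_integral => //.
  - by move=> om _; rewrite lee_fin mulr_ge0.
  - exact/measurable_EFinP/measurable_funM.
  - move=> om _; rewrite lee_fin.
    by have := ler_wpM2l (powR_ge0 (alpha k) p) (moment_le k om); rewrite /g; lra.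
by rewrite integral_cst//= probability_setT mule1.
Qed.

Let V0 k om : 0 <= V k om.
Proof. exact: Phi0. Qed.

Let V_le k om M : enorm (z k om) <= M -> V k om <= c2 * M ^+ 2.
Proof.
move=> zM; apply: (le_trans (Phi_le _)); rewrite ler_wpM2l ?(ltW c20)//.
by rewrite lerXn2r ?nnegrE ?enorm_ge0// (le_trans (enorm_ge0 _) zM).
Qed.

Let r_sq_le k om : r k om ^+ 2 <= (2 + 2 / c1) * (1 + Num.sqrt (V k om) ^+ 2).
Proof.
rewrite sqr_sqrtr//; have := sqr_ge0 (1 - enorm (z k om)).
have := zV k om; have : 0 <= 1 / c1 by rewrite divr_ge0 ?(ltW c10).
rewrite /r sqrrB sqrrD; have := V0 k om; lra.
Qed.

(** The constants [n], [delta] and [K'] are chosen before [A] and [M]: the bound [M] on [A] serves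
    integrability only, so it may later grow with time. *)
Lemma one_step_drift : exists n delta K', [/\ 0 < delta, 0 <= K' &
  forall k A M, alpha k <= delta -> alpha k `^ p <= delta * alpha k ->
  <<s G k >> A -> (forall om, A om -> enorm (z k om) <= M) ->
  (\int[P]_(om in A `&` E k) (V k.+1 om ^+ n.+2)%:E +
     (eta / 4 * alpha k)%:E * \int[P]_(om in A) (V k om ^+ n.+2)%:E <=
   \int[P]_(om in A) (V k om ^+ n.+2)%:E + (K' * alpha k `^ p)%:E)%E].
Proof.
have [n pn] : exists n, p <= n.+2%:R.
  exists (Num.bound p); apply: (le_trans (ltW (archi_boundP _))).
    exact: le_trans ler01 (ltW p1).
  by rewrite ler_nat -addn2 leq_addr.
have ApBp0 : 0 <= Ap + Bp by rewrite addr_ge0// ltW.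
have kap0 : 0 <= 2 + 2 / c1 by rewrite addr_ge0// divr_ge0// ltW.
have [K K0 HK] := truncated_increment n (sqrtr_ge0 (2 * L2)) (ltW L20).
have eta40 : 0 < eta / 4 by rewrite divr_gt0.
have [dl [K' [dl0 K'0 Habs]]] := absorb_remainder n eta40 kap0 K0 ApBp0.
pose Lc := L2 * (C + 1) ^+ 2 / c1.
have Lc0 : 0 < Lc by rewrite divr_gt0// mulr_gt0// exprn_gt0// addr_gt0.
(* The four bounds serve, in order, [absorb_remainder], [powR_truncation], [descent], and the sign
   of the contraction factor [1 - eta / 2 * a]. *)
pose delta := Num.min (Num.min dl 1) (Num.min (eta / 2 / Lc) (2 / eta)).
have eL0 : 0 < eta / 2 / Lc by apply: divr_gt0 => //; exact: divr_gt0.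
have e20 : 0 < 2 / eta by exact: divr_gt0.
exists n, delta, K'; split => //; first by rewrite !lt_min dl0 ltr01 eL0.
move=> k A M; set a := alpha k; set q := a `^ p.
rewrite !le_min => /andP[/andP[adl a1] /andP[aL ae]] qdelta GA zM.
have a0 : 0 < a by exact: alpha0.
have a0' := ltW a0.
have q0 : 0 <= q by exact: powR_ge0.
have qdl : q <= dl * a.
  by apply: (le_trans qdelta); rewrite ler_wpM2r// /delta !ge_min lexx.
have {}aL : a * Lc <= eta / 2 by rewrite -ler_pdivlMr.
have {}ae : eta / 2 * a <= 1.
  by move: ae; rewrite ler_pdivlMr//; lra.
have eta2a : 0 <= eta / 2 * a by rewrite mulr_ge0// divr_ge0// ltW.
have [aq _ _ _] := powR_truncation p1 pn a0 a1 (lexx 0).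
have mA : measurable A := measurable_g_sigma (@GT k) GA.
have mE : measurable (E k) := measurable_g_sigma (@GT k.+1) (@GE k).
pose t om := Num.sqrt (V k om).
have t2 om : t om ^+ 2 = V k om by rewrite sqr_sqrtr.
pose av om := (1 - eta / 2 * a) * V k om.
have av0 om : 0 <= av om by rewrite mulr_ge0// subr_ge0.
have avV om : av om <= V k om by rewrite ler_piMl// lerBlDr lerDl.
pose R1 om := t om ^+ (2 * n.+1) * r k om ^+ 2 * a ^+ 2.
pose R2 om := t om ^+ (2 * n.+1) * r k om ^+ 2 * (a ^+ 2 + q) +
  r k om ^+ (2 * n.+2) * q + t om ^+ (2 * n.+1) * (t om * r k om) * q.
have t0 om : 0 <= t om by exact: sqrtr_ge0.
have r0' om := ltW (r0 k om).
have R10 om : 0 <= R1 om by rewrite !mulr_ge0 ?sqr_ge0 ?exprn_ge0.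
have R20 om : 0 <= R2 om.
  have tn0 := exprn_ge0 (2 * n.+1) (t0 om).
  have rn0 := exprn_ge0 (2 * n.+2) (r0' om).
  apply: addr_ge0; first apply: addr_ge0.
  - apply: mulr_ge0; first exact: mulr_ge0 tn0 (sqr_ge0 _).
    by rewrite addr_ge0 ?sqr_ge0.
  - exact: mulr_ge0.
  - by apply: mulr_ge0 => //; apply: mulr_ge0 => //; exact: mulr_ge0.
have i0 om : 0 <= \1_A om :> R by rewrite indicE.
(* Data for [conditional_mean_bound]: [X] is the truncated next value, [Y] the part free of noise,
   [Q] the weight of [|w k| ^ p], [h] the bound on its conditional mean, and [g] the coefficients of
   the linear noise term. *)
pose X om := \1_(A `&` E k) om * V k.+1 om ^+ n.+2.
pose Y om := \1_A om * (av om ^+ n.+2 + K * R1 om).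
pose Q om := \1_A om * (K * R2 om) * r k om `^ (- p).
pose h om := Ap + Bp * enorm (z k om) `^ p.
pose g (i : 'I_d) om := \1_A om * (n.+2%:R * av om ^+ n.+1 * a) * grad Phi (z k om) 0 i.
pose Vm := c2 * M ^+ 2.
have Vm0 : 0 <= Vm by rewrite mulr_ge0 ?sqr_ge0 ?(ltW c20).
pose B1 := n.+2%:R * Vm ^+ n.+1 * a * (Num.sqrt (2 * L2) * Num.sqrt Vm).
pose B2 := Vm ^+ n.+2 + K' * q.
have B10 : 0 <= B1.
  by rewrite mulr_ge0 ?mulr_ge0 ?sqrtr_ge0 ?exprn_ge0.
have B20 : 0 <= B2 by apply: addr_ge0; [exact: exprn_ge0|exact: mulr_ge0].
(* Of the contraction rate [eta / 2], [absorb_remainder] spends [eta / 4] on the remainders. *)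
have YQh om : Y om + Q om * h om <=
    \1_A om * ((1 - eta / 4 * a) * V k om ^+ n.+2 + K' * q).
  have := Habs (t om) (r k om) a q (t0 om) (r0' om) (@r_sq_le k om) a0 adl q0 qdl aq.
  rewrite -/(R1 om) -/(R2 om) t2 => hb.
  have avm : av om ^+ n.+2 <= (1 - eta / 2 * a) * V k om ^+ n.+2.
    rewrite /av exprMn ler_wpM2r ?exprn_ge0// exprS ler_piMr ?subr_ge0//.
    by rewrite exprn_ile1 ?subr_ge0// lerBlDr lerDl.
  have := ler_wpM2l (mulr_ge0 K0 (R20 om)) (moment_le k om).
  rewrite -/(h om) => hm.
  apply: (@le_trans _ _ (\1_A om * (av om ^+ n.+2 + K * R1 om +
      K * R2 om * (r k om `^ (- p) * h om)))).
    by rewrite /Y /Q le_eqVlt; apply/orP; left; apply/eqP; ring.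
  by rewrite ler_wpM2l//; lra.
have mVk := @mVG k.
have mrk := @mrG k k (leqnn k).
have mt : measurable_fun [set: TG k] t.
  apply: (@measurableT_comp _ _ _ _ _ _ (@Num.sqrt R)) => //.
  by apply: continuous_measurable_fun; exact: sqrt_continuous.
have mav : measurable_fun [set: TG k] av by exact: measurable_funM.
have mR1 : measurable_fun [set: TG k] R1.
  apply: measurable_funM => //; apply: measurable_funM; exact: measurable_funX.
have mR2 : measurable_fun [set: TG k] R2.
  apply: measurable_funD; first apply: measurable_funD.
  - apply: measurable_funM => //; apply: measurable_funM; exact: measurable_funX.
  - by apply: measurable_funM => //; exact: measurable_funX.
  - apply: measurable_funM => //; apply: measurable_funM; first exact: measurable_funX.
    exact: measurable_funM.
have mi : measurable_fun [set: TG k] (\1_A : T -> R).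
  exact: (@measurable_indic _ (TG k)).
have mY : measurable_fun [set: TG k] Y.
  apply: measurable_funM => //; apply: measurable_funD; first exact: measurable_funX.
  exact: measurable_funM.
have mQ : measurable_fun [set: TG k] Q.
  apply: measurable_funM; last exact: mrp.
  by apply: measurable_funM => //; exact: measurable_funM.
have mg i : measurable_fun [set: TG k] (g i).
  apply: measurable_funM; last exact: mgradG.
  apply: measurable_funM => //; apply: measurable_funM => //.
  by apply: measurable_funM => //; exact: measurable_funX.
have mX : measurable_fun [set: T] X.
  apply: measurable_funM; first exact/measurable_indic/measurableI.
  by apply: measurable_funX; exact: (measurable_fun_g_sigma (@GT k.+1) (@mVG k.+1)).
have gB i om : `|g i om| <= B1 + B2.
  apply: (@le_trans _ _ B1); last by rewrite lerDl.
  rewrite /g indicE; have [/set_mem Aom|_] := boolP (om \in A); last by rewrite !mul0r normr0.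
  have VM : V k om <= Vm by apply: V_le; exact: zM.
  rewrite mul1r normrM ger0_norm ?mulr_ge0 ?exprn_ge0//.
  apply: ler_pM; rewrite ?mulr_ge0 ?exprn_ge0//.
    rewrite ler_wpM2r// ler_wpM2l// lerXn2r ?nnegrE//.
    exact: le_trans (avV _) VM.
  apply: (le_trans (coord_le_enorm _ _)); apply: (le_trans (enorm_grad _)).
  by rewrite ler_wpM2l ?sqrtr_ge0// ler_sqrt.
have YB om : Y om + Q om * h om <= B1 + B2.
  apply: (le_trans (YQh om)); apply: (@le_trans _ _ B2); last by rewrite lerDr.
  rewrite indicE; have [/set_mem Aom|_] := boolP (om \in A); last by rewrite mul0r.
  have VM : V k om <= Vm by apply: V_le; exact: zM.
  rewrite mul1r lerD2r; apply: (@le_trans _ _ (V k om ^+ n.+2)).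
    by rewrite ler_piMl ?exprn_ge0// lerBlDr lerDl mulr_ge0// ltW.
  by rewrite lerXn2r ?nnegrE.
have XY om : X om <= Y om + Q om * (enorm (w k om) `^ p) +
    \sum_(i < d) g i om * w k om 0 i.
  have -> : \sum_(i < d) g i om * w k om 0 i =
     \1_A om * (n.+2%:R * av om ^+ n.+1 * (a * inner (grad Phi (z k om)) (w k om))).
    rewrite /inner !mulr_sumr; apply: eq_bigr => i _; rewrite /g; ring.
  rewrite /X /Y /Q indicI /= !indicE.
  have [Aom|_] := boolP (om \in A); last by rewrite !mul0r !addr0.
  rewrite !mul1r -mulrA -powR_ratio.
  set y := enorm (w k om) / r k om.
  have y0 : 0 <= y by rewrite divr_ge0 ?enorm_ge0.
  have ry : r k om * (a * y) = a * enorm (w k om).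
    by rewrite /y; field; rewrite gt_eqF.
  have [_ h1 h2 h3] := powR_truncation p1 pn a0 a1 y0.
  have hl : `|a * inner (grad Phi (z k om)) (w k om)| <=
      Num.sqrt (2 * L2) * t om * (r k om * (a * y)).
    rewrite ry normrM ger0_norm// mulrCA ler_wpM2l//.
    apply: (le_trans (cauchy_schwarz _ _)); rewrite ler_wpM2r ?enorm_ge0//.
    exact: enorm_grad.
  have avt : 0 <= av om <= t om ^+ 2 by rewrite t2 av0 avV.
  have hv : 0 <= V k.+1 om <= av om + a * inner (grad Phi (z k om)) (w k om) +
      L2 * (r k om * (a * y)) ^+ 2.
    by rewrite V0 ry; exact: descent.
  have := HK _ _ _ _ _ _ _ _ _ (t0 om) avt (r0' om) a0' y0 q0 (powR_ge0 y p) hl hv h1 h2 h3.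
  rewrite -/(R1 om) -/(R2 om).
  have -> : (om \in E k) = (a * y <= 1) by apply/idP/idP => [/set_mem|/mem_set].
  by case: (a * y <= 1); rewrite ?mul1r ?mul0r; lra.
have XI : (\int[P]_(om in A `&` E k) (V k.+1 om ^+ n.+2)%:E = \int[P]_om (X om)%:E)%E.
  exact: integral_indicM.
have mVk' := measurable_fun_g_sigma (@GT k) mVk.
have W0 om : 0 <= V k om ^+ n.+2 by rewrite exprn_ge0.
have mW : measurable_fun [set: T] (fun om => V k om ^+ n.+2) by exact: measurable_funX.
have ae4 : eta / 4 * a <= 1 by lra.
have ae40 : 0 <= eta / 4 * a by rewrite mulr_ge0// ltW.
have Y0 om : 0 <= Y om.
  by apply: mulr_ge0 => //; apply: addr_ge0; [exact: exprn_ge0|exact: mulr_ge0].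
have Q0 om : 0 <= Q om.
  by apply: mulr_ge0; [apply: mulr_ge0 => //; exact: mulr_ge0|exact: powR_ge0].
have h0 om : 0 <= h om.
  by apply: addr_ge0; [exact: ltW|apply: mulr_ge0 => //; exact: powR_ge0].
have main : (\int[P]_om (X om)%:E <=
    \int[P]_(om in A) ((1 - eta / 4 * a) * V k om ^+ n.+2 + K' * q)%:E)%E.
  rewrite [leRHS]integral_indicM.
  apply: (@le_trans _ _ (\int[P]_om (Y om + Q om * h om)%:E)%E).
    apply: (@conditional_mean_bound _ _ _ P (G k) (@GT k) d X Y Q _ h g
      (fun i om => w k om 0 i) (B1 + B2) _ _ _ _ _ mX _ mQ _ _ mg gB YB _ _ _ XY).
    - by move=> om; rewrite mulr_ge0 ?exprn_ge0// indicE.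
    - exact: Y0.
    - exact: Q0.
    - by move=> om; exact: powR_ge0.
    - exact: h0.
    - exact: (measurable_fun_g_sigma (@GT k)).
    - exact: (measurableT_comp (measurable_powR _)).
    - exact: mh.
    - by move=> i; exact: wi.
    - by move=> i B GB; exact: w0.
    - by move=> B GB; exact: wp.
  apply: ge0_le_integral => //.
  - move=> om _; rewrite lee_fin; apply: addr_ge0 => //; exact: mulr_ge0.
  - apply/measurable_EFinP/measurable_funD.
      exact: (measurable_fun_g_sigma (@GT k)).
    apply: measurable_funM; last exact: mh.
    exact: (measurable_fun_g_sigma (@GT k)).
  - apply/measurable_EFinP/measurable_funM.
      exact: (measurable_fun_g_sigma (@GT k)).
    by apply: measurable_funD => //; exact: measurable_funM.
  - by move=> om _; rewrite lee_fin.
rewrite XI; apply: (le_trans (leeD2r _ main)).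
have mWA : measurable_fun A (fun om => (V k om ^+ n.+2)%:E).
  exact/measurable_EFinP/measurable_funTS.
have W0A om : A om -> (0 <= (V k om ^+ n.+2)%:E)%E by rewrite lee_fin.
have K'q0 : 0 <= K' * q by exact: mulr_ge0.
rewrite -ge0_integralZl//.
rewrite -ge0_integralD//; first last.
- exact: measurable_funeM.
- by move=> om Aom; apply: mule_ge0; [rewrite lee_fin|exact: W0A].
- apply/measurable_EFinP/measurable_funTS/measurable_funD => //.
  exact: measurable_funM.
- move=> om _; rewrite lee_fin; apply: addr_ge0 => //.
  by apply: mulr_ge0 => //; rewrite subr_ge0.
apply: (@le_trans _ _ (\int[P]_(om in A) ((V k om ^+ n.+2)%:E + (K' * q)%:E))%E).
  rewrite le_eqVlt; apply/orP; left; apply/eqP; apply: eq_integral => om _.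
  by rewrite -EFinM -!EFinD; congr EFin; ring.
rewrite ge0_integralD//.
rewrite leeD2l// integral_cst// -[leRHS]mule1 lee_wpmul2l ?lee_fin//.
exact: probability_le1.
Qed.

(** At a fixed point the drift inequality reads [0 <= - eta * Phi], so [Phi] vanishes there and its
    quadratic lower bound forces [y = xstar]. *)
Lemma fixed_point_unique y : H y = y -> y = xstar.
Proof.
move=> Hy; have := driftH y; rewrite Hy subrr.
have -> : inner (grad Phi (y - xstar)) 0 = 0.
  by rewrite -(scale0r (0 : 'rV[R]_d)) innerZr mul0r.
rewrite mulNr oppr_ge0 pmulr_rle0// => Phile.
have : c1 * enorm (y - xstar) ^+ 2 <= 0 := le_trans (Phi_ge y) Phile.
rewrite pmulr_rle0// => e2; apply/eqP; rewrite -subr_eq0; apply/eqP/enorm_eq0.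
by apply/eqP; rewrite -sqrf_eq0 eq_le e2 sqr_ge0.
Qed.

(** * Almost sure convergence *)

Hypothesis alpha_sum : (\sum_(0 <= k <oo) (alpha k)%:E = +oo)%E.
Hypothesis alpha_powR_sum : (\sum_(0 <= k <oo) (alpha k `^ p)%:E < +oo)%E.

Lemma escape_finite : {ae P, forall om, exists N, forall k, (N <= k)%N -> E k om}.
Proof.
have mE k : measurable (~` E k).
  exact: measurableC (measurable_g_sigma (@GT k.+1) (@GE k)).
have ApBp0 : 0 <= Ap + Bp by rewrite addr_ge0// ltW.
have PE : (\sum_(0 <= k <oo) P (~` E k) < +oo)%E.
  apply: (@le_lt_trans _ _ (\sum_(0 <= k <oo) (Ap + Bp)%:E * (alpha k `^ p)%:E)%E).
    by apply: lee_nneseries => // k _; rewrite -EFinM; exact: escape_prob.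
  rewrite nneseriesZl//; last by move=> k _; rewrite lee_fin powR_ge0.
  by rewrite lte_mul_pinfty// lee_fin.
have := lim_sup_set_cvg0 mE PE => N0.
exists (lim_sup_set (fun k => ~` E k)); split => //.
  by apply: bigcap_measurable => // n _; exact: bigcup_measurable.
move=> om /= noN n _; apply: contrapT => hn; apply: noN; exists n => k nk.
by apply: contrapT => Ek; apply: hn; exists k.
Qed.

(* Index shift by [s]: the supermartingale argument starts at a time after which
   the step sizes are small and the truncation events hold. *)
Let D (s M : nat) := fix D (j : nat) : set T :=
  match j with
  | 0%N => [set om | enorm (z s om) <= M%:R]
  | j'.+1 => D j' `&` E (j' + s)
  end.

Let GD s M j : <<s G (j + s) >> (D s M j).
Proof.
elim: j => [|j ih].
  have mz0 : measurable_fun [set: TG s] (fun om => enorm (z s om)).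
    by apply: (@measurable_enorm _ _ _ (TG s) (z s)) => i; exact: mzG.
  have := mz0 measurableT _ (measurable_itv `]-oo, M%:R]).
  by rewrite setTI; congr (<<s G s >> _).
apply: (@measurableI _ (TG (j + s).+1)); last exact: GE.
by apply: sub_smallest2r ih; [exact: smallest_sigma_algebra|exact: Gmono].
Qed.

(** On [E k] the scaled noise is at most [r k], so a deterministic bound on the distance to [xstar]
    passes from each step to the next. *)
Let D_bounded s M j : exists B, forall om, D s M j om -> enorm (z (j + s) om) <= B.
Proof.
elim: j => [|j [B hB]]; first by exists M%:R.
set k := (j + s)%N.
exists (B + (alpha k * (C + 1) * B + (1 + B))) => om [/hB zB Ek].
rewrite -/k in zB; rewrite addSn -/k sa_iterS.
have aw : alpha k * enorm (w k om) <= r k om.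
  by move: Ek; rewrite /E /= mulrA ler_pdivrMr ?mul1r.
apply: (le_trans (ler_enormD _ _)); apply: lerD => //.
rewrite enormZ ger0_norm ?(ltW (alpha0 k))//.
apply: (@le_trans _ _ (alpha k * (enorm (H (x k om) - x k om) + enorm (w k om)))).
  by rewrite ler_wpM2l ?(ltW (alpha0 k))// ler_enormD.
rewrite mulrDr; apply: lerD; last by apply: (le_trans aw); rewrite lerD2l.
rewrite -mulrA ler_wpM2l ?(ltW (alpha0 k))//; apply: (le_trans (enorm_drift _)).
by rewrite ler_wpM2l// addr_ge0// ltW.
Qed.

Lemma sa_iter_cvg : {ae P, forall om, enorm (x k om - xstar) @[k --> \oo] --> 0}.
Proof.
have [n [delta [K' [dl0 K'0 drift]]]] := one_step_drift.
have [N hN] := summable_powR_small p1 alpha0 alpha_powR_sum dl0.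
have eta40 : 0 < eta / 4 by rewrite divr_gt0.
(* The start [N + i] lies beyond [N], where the step sizes are small enough for [one_step_drift].
   Integer radii [M] leave only countably many null sets. *)
have aeD i M : {ae P, forall om, (forall j, D (N + i) M j om) ->
    V (j + (N + i)) om ^+ n.+2 @[j --> \oo] --> 0}.
  set s := (N + i)%N.
  apply: (@supermartingale_cvg0 _ _ _ P (fun j => G (j + s)) _ _
    (fun j om => V (j + s) om ^+ n.+2) (D s M) (fun j => eta / 4 * alpha (j + s))
    (fun j => K' * alpha (j + s) `^ p)).
  - by move=> j; exact: GT.
  - by move=> j; exact: Gmono.
  - by move=> j om; exact: exprn_ge0.
  - by move=> j; apply: measurable_funX; exact: mVG.
  - by move=> j; exact: GD.
  - by move=> j om [].
  - have mD0 : measurable (D s M 0) := measurable_g_sigma (@GT s) (@GD s M 0).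
    apply: (@le_lt_trans _ _ (\int[P]_(om in D s M 0) ((c2 * M%:R ^+ 2) ^+ n.+2)%:E)%E).
      apply: ge0_le_integral => //.
      + by move=> om _; rewrite lee_fin exprn_ge0.
      + apply/measurable_EFinP/measurable_funTS/measurable_funX.
        exact: (measurable_fun_g_sigma (@GT s) (@mVG s)).
      + move=> om zM; rewrite lee_fin lerXn2r ?nnegrE//; last exact: V_le.
        by rewrite mulr_ge0// ltW.
    by rewrite integral_cst// lte_mul_pinfty ?lee_fin ?exprn_ge0 ?mulr_ge0 ?(ltW c20)//
      (le_lt_trans (probability_le1 _ _))// ltry.
  - by move=> j; rewrite mulr_ge0// ltW.
  - by move=> j; rewrite mulr_ge0// powR_ge0.
  - move=> j A GA AD; have [B hB] := D_bounded s M j.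
    have [h1 h2] : alpha (j + s) <= delta /\ alpha (j + s) `^ p <= delta * alpha (j + s).
      by apply: hN; rewrite /s addnCA leq_addr.
    have := @drift (j + s)%N A B h1 h2 GA (fun om Aom => hB om (AD om Aom)).
    by rewrite /= setIA (setIidl AD).
  - move=> L m.
    have [K hK] := nneseries_unbounded (fun k => ltW (alpha0 k)) alpha_sum
      (L / (eta / 4)) (m + s).
    exists (K - s)%N; rewrite -mulr_sumr -ler_pdivrMl// mulrC.
    by apply: (le_trans hK); rewrite big_addn.
  (* The [+ 1] allows for [K' = 0]. *)
  - move=> e e0; have e1 : 0 < e / (K' + 1) by rewrite divr_gt0// ltr_wpDl.
    have [m hm] := nneseries_tail_small (fun k => powR_ge0 (alpha k) p)
      alpha_powR_sum e1.
    exists m => K; rewrite -mulr_sumr.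
    have tail0 : 0 <= \sum_(m <= j < K) alpha (j + s) `^ p.
      by apply: sumr_ge0 => j _; exact: powR_ge0.
    have tail : \sum_(m <= j < K) alpha (j + s) `^ p < e / (K' + 1).
      apply: le_lt_trans (hm (K + s)%N).
      have -> : \sum_(m <= j < K) alpha (j + s) `^ p =
          \sum_(m + s <= j < K + s) alpha j `^ p by rewrite big_addn addnK.
      have [sK|Ks] := leqP (m + s) (K + s).
        rewrite [leRHS](@big_cat_nat _ _ _ (m + s))//= ?leq_addr// lerDr.
        by apply: sumr_ge0 => j _; exact: powR_ge0.
      rewrite big_geq ?(ltnW Ks)//.
      by apply: sumr_ge0 => j _; exact: powR_ge0.
    move: tail; rewrite ltr_pdivlMr ?ltr_wpDl//; lra.
have aeD' : {ae P, forall om, forall i M, (forall j, D (N + i) M j om) ->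
    V (j + (N + i)) om ^+ n.+2 @[j --> \oo] --> 0}.
  by apply: ae_foralln => i; apply: ae_foralln => M; exact: aeD.
(* On almost every path [E k] holds from some [N1] on; the start [N + N1] and an integer above the
   norm there then put the path in every [D s M j]. *)
apply: filterS2 escape_finite aeD' => om [N1 hE] hD.
set s := (N + N1)%N in hD *.
pose M := Num.bound (enorm (z s om)).
have DM j : D s M j om.
  elim: j => [|j ih].
    by apply: ltW; apply: archi_boundP; exact: enorm_ge0.
  by split => //; apply: hE; rewrite /s addnCA addnA leq_addl.
have hV := hD N1 M DM.
apply/cvgrPdist_lt => e e0.
have ce : 0 < (c1 * e ^+ 2) ^+ n.+2 by rewrite exprn_gt0// mulr_gt0// exprn_gt0.
have [J _ hJ] := (cvgrPdist_lt _ _).1 hV _ ce.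
exists (J + s)%N => // k /= Jk.
have sk : (s <= k)%N by apply: leq_trans Jk; exact: leq_addl.
have := hJ (k - s)%N; rewrite /= leq_subRL// addnC Jk => /(_ isT).
rewrite subnK// !sub0r !normrN !ger0_norm ?exprn_ge0 ?enorm_ge0//.
have ce0 : 0 <= c1 * e ^+ 2 by rewrite mulr_ge0 ?exprn_ge0 ?ltW.
rewrite ltr_pXn2r ?nnegrE// => Vlt.
have := le_lt_trans (Phi_ge (x k om)) Vlt.
by rewrite ltr_pM2l// ltr_pXn2r ?nnegrE ?enorm_ge0 ?ltW.
Qed.

End StochasticApproximation.

Theorem theorem1 (R : realType) (d : nat) (d0 : measure_display)
  (T : measurableType d0) (P : probability T R)
  (H : 'rV[R]_d -> 'rV[R]_d) (x0 : 'rV[R]_d) (alpha : nat -> R)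
  (w : nat -> T -> 'rV[R]_d) (p : R)
  (xstar : 'rV[R]_d) (Phi : 'rV[R]_d -> R) (eta c1 c2 L2 Ap Bp C : R) :
  1 < p ->
  (* step sizes: positive, non-increasing, sum = oo, sum alpha^p < oo *)
  (forall k, 0 < alpha k) ->
  (forall k, alpha k.+1 <= alpha k) ->
  (\sum_(0 <= k <oo) (alpha k)%:E = +oo)%E ->
  (\sum_(0 <= k <oo) (alpha k `^ p)%:E < +oo)%E ->
  (* w_k are random vectors (each coordinate measurable) *)
  (forall k (i : 'I_d), measurable_fun setT (fun om => w k om 0 i)) ->
  (* Drift Assumption *)
  H xstar = xstar ->
  (forall y, 0 <= Phi y) -> (forall y, differentiable Phi y) ->
  0 < eta -> 0 < c1 -> 0 < c2 -> 0 < L2 ->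
  (forall y, inner (grad Phi (y - xstar)) (H y - y) <= - eta * Phi (y - xstar)) ->
  (forall y z, Phi z <= Phi y + inner (grad Phi y) (z - y)
                         + L2 / 2 * enorm (z - y) ^+ 2) ->
  (forall y, c1 * enorm (y - xstar) ^+ 2 <= Phi (y - xstar)) ->
  (forall y, Phi (y - xstar) <= c2 * enorm (y - xstar) ^+ 2) ->
  (* Unbiased Noise Assumption: w_k integrable and E[w_k | F_k] = 0 a.s.,
     stated through the defining property of conditional expectation *)
  (forall k (i : 'I_d), P.-integrable setT (fun om => (w k om 0 i)%:E)) ->
  (forall k (i : 'I_d) (A : set T), filtr (sa_iter H alpha w x0) k A ->
      (\int[P]_(om in A) (w k om 0 i)%:E = 0)%E) ->
  (* p-th Moment Noise Assumption:
     E[ ||w_k||^p | F_k ] <= A_p + B_p ||x_k - x*||^p a.s. *)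
  0 < Ap -> 0 <= Bp ->
  (forall k (A : set T), filtr (sa_iter H alpha w x0) k A ->
      (\int[P]_(om in A) (enorm (w k om) `^ p)%:E
        <= \int[P]_(om in A)
             (Ap + Bp * enorm (sa_iter H alpha w x0 k om - xstar) `^ p)%:E)%E) ->
  (* Lipschitz Assumption *)
  0 < C -> (forall y z, enorm (H y - H z) <= C * enorm (y - z)) ->
  (* conclusion: x* is the unique fixed point and x_k -> x* a.s. *)
  (forall y, H y = y -> y = xstar) /\
  {ae P, forall om,
     enorm (sa_iter H alpha w x0 k om - xstar) @[k --> \oo] --> 0}.
Proof.
move=> p1 al0 _ als alps mw Hst Phi0 dPhi eta0 c10 c20 L20 drift smooth Pge Ple
  wi w0 Ap0 Bp0 wp C0 lipH; split.
  by move=> y; apply: (fixed_point_unique eta0 c10 drift Pge).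
exact: (sa_iter_cvg p1 al0 mw Hst Phi0 dPhi eta0 c10 c20 L20 drift smooth Pge Ple
  C0 lipH wi w0 Ap0 Bp0 wp als alps).
Qed.
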